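(* There exists an algorithm $\mathcal{A}$ that is fixed parameter tractable with respect to the integer parameters $d$ and $K$ and has the following property: for all positive integers $d$ and $K$ there exists an integer $m$ (depending only on $d$ and $K$) such that, whenever $\mathcal{A}$ receives as input a graph $G^R$ together with the integers $d$ and $K$, where $G$ is a $d$-degenerate graph, $R$ is a $K$-node pattern and $(V_u)_{u\in V(R)}$ is a partition of $V(G)$ (none of $G$, $R$ or the partition is given to $\mathcal{A}$), the algorithm outputs a graph $H$ on the vertex set $V(G)$ such that $G$ and $H$ agree on all but at most $m$ vertices. In particular, the graph $H$ is $(d+m)$-degenerate.
   Context: All graphs are finite and simple unless stated otherwise. A graph is $d$-degenerate if its vertices can be ordered so that each vertex has at most $d$ neighbors preceding it. A pattern is a finite graph $R$ which may contain loops (its vertices are called nodes) such that $R$ contains neither two adjacent twins that both have loops nor two non-adjacent twins neither of which has a loop; here two nodes $u,u'$ are twins if every node $w\notin\{u,u'\}$ is adjacent to both or to neither of them. Given a graph $G$, a pattern $R$ and a partition $(V_u)_{u\in V(R)}$ of $V(G)$ indexed by the nodes of $R$, the graph $G^R$ has vertex set $V(G)$ and is obtained from $G$ by complementing the adjacency between all pairs of distinct vertices inside $V_u$ for each node $u$ with a loop, and between all pairs $v\in V_u$, $v'\in V_{u'}$ for each edge $uu'$ of $R$ with $u\neq u'$; equivalently, for distinct $v\in V_u$, $v'\in V_{u'}$, $vv'$ is an edge of $G^R$ iff exactly one of ''$vv'\in E(G)$'' and ''$uu'\in E(R)$'' holds. Two graphs $G,H$ on the same vertex set $V$ agree on all but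 at most $m$ vertices if there is a set $U\subseteq V$ with $|U|\le m$ such that $G\setminus U=H\setminus U$. *)

(* Defs.v *)
From mathcomp Require Import all_boot.
Set Implicit Arguments.
Unset Strict Implicit.
Unset Printing Implicit Defensive.

Record sgraph (n : nat) := SGraph {
  adj :> rel 'I_n;
  adj_sym : symmetric adj;
  adj_irr : irreflexive adj
}.

(* [pos] is an ordering of the vertices: [pos v] is the position of [v]. *)
Definition degenerate n (d : nat) (G : sgraph n) : Prop :=
  exists2 pos : 'I_n -> 'I_n, injective pos &
    forall v, #|[set w | G v w & pos w < pos v]| <= d.

Definition twins (T : finType) (r : rel T) (u u' : T) : Prop :=
  u != u' /\ forall w, w != u -> w != u' -> r u w = r u' w.

Record pattern (K : nat) := Pattern {
  padj :> rel 'I_K;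
  padj_sym : symmetric padj;
  pattern_loops : forall u u', twins padj u u' ->
    ~ [/\ padj u u', padj u u & padj u' u'];
  pattern_noloops : forall u u', twins padj u u' ->
    ~ [/\ ~~ padj u u', ~~ padj u u & ~~ padj u' u']
}.

(* A partition of the vertices indexed by the nodes of [R] is given by the map
   [part] sending a vertex to the node of its part; parts may be empty. *)
Section Complementation.
Variables (n K : nat) (G : sgraph n) (R : pattern K) (part : 'I_n -> 'I_K).

Definition compl_rel : rel 'I_n :=
  fun v w => (v != w) && (G v w (+) R (part v) (part w)).

Lemma compl_rel_sym : symmetric compl_rel.
Proof. by move=> v w; rewrite /compl_rel eq_sym adj_sym padj_sym. Qed.

Lemma compl_rel_irr : irreflexive compl_rel.
Proof. by move=> v; rewrite /compl_rel eqxx. Qed.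

Definition complement_along : sgraph n := SGraph compl_rel_sym compl_rel_irr.
End Complementation.

Definition agree_upto n (m : nat) (G H : sgraph n) : Prop :=
  exists2 U : {set 'I_n}, #|U| <= m &
    forall v w, v \notin U -> w \notin U -> G v w = H v w.

(* Algorithms are programs of a random access machine with finitely many
   (named by constants) registers and arrays of natural numbers.  The only
   arithmetic operations are addition and truncated subtraction; there is no
   unit-cost multiplication, so that this cost model is polynomially equivalent
   to Turing machines. *)
Inductive expr : Type :=
  | Cst of nat
  | Reg of nat                  (* register *)
  | Get of nat & expr           (* array cell: array name, index *)
  | Add of expr & expr
  | Sub of expr & expr.

Inductive cmd : Type :=
  | Skip
  | Assign of nat & expr        (* register := value *)
  | Store of nat & expr & expr  (* array[index] := value *)
  | Seq of cmd & cmd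
  | IfNZ of expr & cmd & cmd
  | WhileNZ of expr & cmd.

Record state := State { regs : nat -> nat; arrs : nat -> nat -> nat }.

Fixpoint eval (s : state) (e : expr) : nat :=
  match e with
  | Cst k => k
  | Reg x => regs s x
  | Get a e1 => arrs s a (eval s e1)
  | Add e1 e2 => eval s e1 + eval s e2
  | Sub e1 e2 => eval s e1 - eval s e2
  end.

Definition set_reg (s : state) (x k : nat) : state :=
  State (fun y => if y == x then k else regs s y) (arrs s).

Definition set_cell (s : state) (a i k : nat) : state :=
  State (regs s)
    (fun b j => if (b == a) && (j == i) then k else arrs s b j).

(* [exec c s s' t]: started in state [s], the program [c] halts in state [s']
   after [t] steps.  Every executed assignment and every evaluated test is one
   step: the expressions of a fixed program have bounded size, so charging for
   their evaluation would only change [t] by a constant factor. *)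
Inductive exec : cmd -> state -> state -> nat -> Prop :=
  | exec_skip s : exec Skip s s 1
  | exec_assign s x e : exec (Assign x e) s (set_reg s x (eval s e)) 1
  | exec_store s a e1 e2 :
      exec (Store a e1 e2) s (set_cell s a (eval s e1) (eval s e2)) 1
  | exec_seq s s' s'' c1 c2 t1 t2 :
      exec c1 s s' t1 -> exec c2 s' s'' t2 ->
      exec (Seq c1 c2) s s'' (t1 + t2)
  | exec_if_then s s' e c1 c2 t :
      eval s e != 0 -> exec c1 s s' t -> exec (IfNZ e c1 c2) s s' t.+1
  | exec_if_else s s' e c1 c2 t :
      eval s e = 0 -> exec c2 s s' t -> exec (IfNZ e c1 c2) s s' t.+1
  | exec_while_end s e c : eval s e = 0 -> exec (WhileNZ e c) s s 1
  | exec_while_loop s s' s'' e c t1 t2 :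
      eval s e != 0 -> exec c s s' t1 -> exec (WhileNZ e c) s' s'' t2 ->
      exec (WhileNZ e c) s s'' (t1 + t2).+1.

Lemma exec_det c s s1 s2 t1 t2 :
  exec c s s1 t1 -> exec c s s2 t2 -> s1 = s2 /\ t1 = t2.
Proof.
move=> h; elim: h s2 t2 => {c s s1 t1}; intros;
  match goal with h : exec _ _ ?s ?t |- _ = ?s /\ _ = ?t =>
    inversion h; subst => //= end;
  try by match goal with
    h : is_true (eval ?s ?e != 0), h' : eval ?s ?e = 0 |- _ =>
      rewrite h' in h end.
all: repeat match goal with
  | IH : forall s2 t2, exec ?c ?s s2 t2 -> _, h : exec ?c ?s _ _ |- _ =>
      let E1 := fresh in let E2 := fresh in
      case: (IH _ _ h) => E1 E2; subst; clear IH
  end; by [].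
Qed.

(* Row-major adjacency matrix, followed by zeros. *)
Definition adj_array n (G : sgraph n) (k : nat) : nat :=
  [exists i : 'I_n, exists j : 'I_n, (k == i * n + j) && G i j].

(* Input: the number of vertices and the integers [d] and [K] in registers 0, 1
   and 2, the graph in array 0, and zeros elsewhere. *)
Definition graph_input n (d K : nat) (G : sgraph n) : state :=
  State (nth 0 [:: n; d; K]) (fun a => if a == 0 then adj_array G else fun=> 0).

(* Output: the graph in array 1. *)
Definition outputs n (p : cmd) (d K : nat) (G H : sgraph n) : Prop :=
  exists s t, exec p (graph_input d K G) s t /\
    forall i j : 'I_n, arrs s 1 (i * n + j) = nat_of_bool (H i j).

Definition computable2 (f : nat -> nat -> nat) : Prop :=
  exists p : cmd, forall a b, exists s t,
    exec p (State (nth 0 [:: a; b]) (fun _ _ => 0)) s t /\ regs s 0 = f a b.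

(* [n.+1] rather than [n] only matters for the graph without vertices. *)
Definition fpt (p : cmd) : Prop :=
  exists (f : nat -> nat -> nat) (c : nat), computable2 f /\
    forall n d K (G : sgraph n), exists s t,
      exec p (graph_input d K G) s t /\ t <= f d K * n.+1 ^ c.

(* Main.v *)
Require Import Defs.
From mathcomp Require Import all_boot zify.
Set Implicit Arguments.
Unset Strict Implicit.
Unset Printing Implicit Defensive.

(** The graph [G] is determined by [G^R] up to boundedly many vertices.  If two
    sparse graphs differ by a pattern on boundedly many cells, then two large
    cells cannot be complemented relative to each other, since the union of the
    two graphs would contain a dense piece; so the graphs differ only at the
    small cells.  Hence it suffices to find some sparse graph differing from
    [G^R] by a pattern with boundedly many nodes.

    Let some vertices be coloured by the names of their parts.  A part with at
    least [4 d + 4] coloured vertices is represented; by sparsity, all but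
    [4 d] vertices have towards it the majority adjacency prescribed by the
    pattern.  Assigning a vertex to a represented part with the same majority
    adjacencies gives a guess for [G], in which (up to boundedly many vertices)
    wrong pairs consist of vertices of unrepresented parts.  Consider the first
    prefix [v_0 .. v_i] of the vertices on which the guess fails, because it has
    a nonempty core of large minimum degree, or too many vertices fit no
    represented part.  The guess is sparse on the previous prefix, so its wrong
    pairs there are covered by boundedly many vertices; counting edges of the
    core shows that its vertices of linear degree, which are boundedly many,
    include [4 d + 4] vertices of one unrepresented part.  So colouring a
    bounded batch of vertices represents a new part, and [K] rounds suffice.
    The algorithm tries all sequences of colours for the batches. *)

(** * Sparse graphs and cores *)

Section Sparse.
Variable T : finType.
Implicit Types (G H : rel T) (X Y Z C : {set T}).

Definition pairs G X Y : nat := \sum_(v in X) \sum_(w in Y) G v w.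

Definition deg G Z v : nat := \sum_(w in Z) G v w.

(** The counting form of degeneracy. [X] and [Y] may overlap and pairs are ordered, so the same
    bound covers edges inside one set and edges between two sets. *)
Definition sparse d G Z : Prop := forall X Y,
  X \subset Z -> Y \subset Z -> pairs G X Y <= d * (#|X| + #|Y|).

Lemma sum_boolE X (P : pred T) : \sum_(w in X) (P w : nat) = #|[set w in X | P w]|.
Proof.
rewrite -sum1_card big_mkcond [RHS]big_mkcond; apply: eq_bigr => w _.
by rewrite inE; case: (w \in X); case: (P w).
Qed.

Lemma pairsC G X Y : symmetric G -> pairs G X Y = pairs G Y X.
Proof.
move=> sG; rewrite /pairs exchange_big; apply: eq_bigr => v _.
by apply: eq_bigr => w _; rewrite sG.
Qed.

Lemma deg_le_card G Z v : deg G Z v <= #|Z|.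
Proof.
rewrite /deg sum_boolE subset_leq_card //; apply/subsetP=> w.
by rewrite inE => /andP[].
Qed.

Lemma deg_sub G X Y v : X \subset Y -> deg G X v <= deg G Y v.
Proof.
move=> /subsetP sXY; rewrite /deg !sum_boolE; apply/subset_leq_card/subsetP => w.
by rewrite !inE => /andP[/sXY -> ->].
Qed.

Lemma sparse_sub d G Z Z' : Z' \subset Z -> sparse d G Z -> sparse d G Z'.
Proof. by move=> sZ sp X Y sX sY; apply: sp; apply: subset_trans sZ. Qed.

Lemma pairsD1 G X Y v : v \in X -> pairs G X Y = deg G Y v + pairs G (X :\ v) Y.
Proof. by move=> vX; rewrite /pairs (big_setD1 v). Qed.

(** Deleting [v] from [X], then from [Y], loses at most [d] pairs for each set containing [v], which
    is exactly the drop of the right-hand side. *)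
Lemma sparse_peel d G Z v : symmetric G -> v \in Z -> deg G Z v <= d ->
  sparse d G (Z :\ v) -> sparse d G Z.
Proof.
move=> sG vZ dv sp X Y sX sY.
have sD (W : {set T}) : W \subset Z -> W :\ v \subset Z :\ v by move=> sW; apply: setSD.
have step (W W' : {set T}) : W' \subset Z ->
    pairs G W W' <= d * (v \in W) + pairs G (W :\ v) W'.
  move=> sW; case: (boolP (v \in W)) => vW.
    by rewrite (pairsD1 _ _ vW) muln1 leq_add2r (leq_trans (deg_sub _ _ sW)).
  rewrite (_ : W :\ v = W) ?leq_addl //; apply/setP=> u; rewrite !inE.
  by case: eqP => //= ->; rewrite (negPf vW).
apply: leq_trans (step _ _ sY) _; rewrite (pairsC _ _ sG).
have sX' : X :\ v \subset Z by apply: subset_trans (subD1set _ _) sX.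
apply: leq_trans (_ : d * (v \in X) + (d * (v \in Y) +
  pairs G (Y :\ v) (X :\ v)) <= _); first by rewrite leq_add2l; apply: step.
have := sp (Y :\ v) (X :\ v) (sD _ sY) (sD _ sX).
by rewrite (cardsD1 v X) (cardsD1 v Y); lia.
Qed.

Definition stable dp H C : bool := [forall v in C, dp < deg H C v].

(** A union of stable sets is stable, so this is the largest stable subset of [Z]: the usual core of
    minimum degree [dp + 1]. *)
Definition core dp H Z : {set T} :=
  \bigcup_(C : {set T} | (C \subset Z) && stable dp H C) C.

Lemma core_sub dp H Z : core dp H Z \subset Z.
Proof. by apply/bigcupsP => C /andP[]. Qed.

Lemma sub_core dp H Z C : C \subset Z -> stable dp H C -> C \subset core dp H Z.
Proof. by move=> CZ sC; apply: bigcup_sup; rewrite CZ. Qed.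

Lemma core_mono dp H Z Z' : Z \subset Z' -> core dp H Z \subset core dp H Z'.
Proof.
move=> sZ; apply/bigcupsP => C /andP[CZ sC].
by apply: sub_core => //; apply: subset_trans sZ.
Qed.

Lemma stable_core dp H Z : stable dp H (core dp H Z).
Proof.
apply/forall_inP => v /bigcupP[C /andP[CZ sC] vC].
have/forall_inP/(_ v vC) lt := sC.
by apply: leq_trans lt _; apply/deg_sub/sub_core.
Qed.

(** A nonempty set with empty core is not stable, so it has a vertex of degree at most [dp]; peel it
    off and induct on the size. *)
Lemma core0_sparse dp H Z :
  symmetric H -> core dp H Z = set0 -> sparse dp H Z.
Proof.
move=> sH; have [k] := ubnP #|Z|; elim: k Z => // k IH Z; rewrite ltnS => Zk c0.
case: (boolP (stable dp H Z)) => [sZ|].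
  have := sub_core (subxx Z) sZ; rewrite c0 subset0 => /eqP -> X Y.
  by rewrite !subset0 => /eqP -> _; rewrite /pairs big_set0.
case/forall_inPn => v vZ; rewrite -leqNgt => dv.
apply: (sparse_peel sH vZ dv); apply: IH.
  by rewrite (cardsD1 v) vZ in Zk.
by apply/eqP; rewrite -subset0 -c0 core_mono // subD1set.
Qed.

(** Double counting gives [#|A| * (#|X| - 2 * d - 2) <= 2 * d * #|X|], and the second factor is at
    least half of [#|X|]. *)
Lemma sparse_high d G X (A : {set T}) : sparse d G setT -> 4 * d + 4 <= #|X| ->
  (forall v, v \in A -> #|X| <= 2 * deg G X v + 2) -> #|A| <= 4 * d.
Proof.
move=> sp Xs hA.
have : #|A| * #|X| <= \sum_(v in A) (2 * deg G X v + 2).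
  by rewrite -sum_nat_const; apply: leq_sum.
rewrite big_split /= sum_nat_const -big_distrr /= -/(pairs G A X).
have := sp A X (subsetT _) (subsetT _); nia.
Qed.

End Sparse.

(** Each adjacent pair is charged to its later end: at most [d * #|X|] charges fall on the end in
    [X] and [d * #|Y|] on the end in [Y]. *)
Lemma degenerate_sparse n d (G : sgraph n) : degenerate d G -> sparse d G setT.
Proof.
move=> [pos pos_inj hpos] X Y _ _.
have half (Z W : {set 'I_n}) :
    \sum_(v in Z) \sum_(w in W) (G v w && (pos w < pos v)) <= d * #|Z|.
  rewrite mulnC -sum_nat_const; apply: leq_sum => v _; rewrite sum_boolE.
  apply: leq_trans (hpos v); apply/subset_leq_card/subsetP => w.
  by rewrite !inE => /andP[].
rewrite mulnDr; apply: leq_trans (leq_add (half X Y) (half Y X)).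
rewrite [X in _ + X]exchange_big -big_split leq_sum // => v _.
rewrite -big_split leq_sum // => w _ /=; rewrite (adj_sym G w v).
case: (boolP (G v w)) => //= Gvw; case: (ltngtP (pos v) (pos w)) => // e.
by move: Gvw; rewrite (pos_inj _ _ (val_inj e)) adj_irr.
Qed.

(** Ranking a vertex by the number of smaller keys turns any injective key into positions in
    ['I_n]. *)
Lemma key_degenerate n d (G : sgraph n) (key : 'I_n -> nat) : injective key ->
  (forall v, #|[set w | G v w & key w < key v]| <= d) -> degenerate d G.
Proof.
move=> key_inj hkey.
have rk v : #|[set w | key w < key v]| < n.
  rewrite -[X in _ < X]card_ord -cardsT proper_card // properE subsetT /=.
  by apply/subsetPn; exists v; rewrite !inE // ltnn.
have rk_lt v w : (#|[set u | key u < key w]| < #|[set u | key u < key v]|)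
    = (key w < key v).
  apply/idP/idP; last first.
    move=> lt; rewrite proper_card // properE; apply/andP; split.
      by apply/subsetP=> u; rewrite !inE => /ltn_trans; apply.
    by apply/subsetPn; exists w; rewrite !inE // ltnn.
  apply: contraTT; rewrite -!leqNgt => le.
  by apply/subset_leq_card/subsetP=> u; rewrite !inE => /leq_trans; apply.
exists (fun v => Ordinal (rk v)) => [v w /(congr1 val) /= e|v].
  apply: key_inj; apply/eqP; rewrite eqn_leq; apply/andP.
  by split; rewrite leqNgt -rk_lt e ltnn.
apply: leq_trans (hkey v); apply/subset_leq_card/subsetP => w.
by rewrite !inE /= rk_lt.
Qed.

Lemma agree_degenerate n d m (G H : sgraph n) :
  degenerate d G -> agree_upto m G H -> degenerate (d + m) H.
Proof.
move=> [pos pos_inj hpos] [U Um eqGH].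
(* The vertices of [U] come first; a vertex outside [U] is preceded by its old earlier neighbours
   and at most [m] new ones. *)
pose key v := (v \notin U) * n + pos v.
apply: (@key_degenerate _ _ _ key) => [v w|v].
  rewrite /key => e; apply: pos_inj; apply: val_inj => /=.
  have := ltn_ord (pos v); have := ltn_ord (pos w).
  by move: e; case: (v \in U); case: (w \in U) => /=; lia.
apply: leq_trans (_ : #|U :|: [set w | G v w & pos w < pos v]| <= _); last first.
  by apply: leq_trans (leq_card_setU _ _) _; rewrite addnC leq_add.
apply/subset_leq_card/subsetP => w; rewrite !inE /key => /andP[Hvw lt].
case: (boolP (w \in U)) => //= wU; rewrite wU in lt.
have vU : v \notin U.
  apply/negP => vU; move: lt; rewrite vU /=; have := ltn_ord (pos v); lia.
by rewrite vU ltn_add2l in lt; rewrite eqGH // Hvw lt.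
Qed.

Lemma card_bigcup_le (T I : finType) (P : pred I) (F : I -> {set T}) k :
  (forall i, P i -> #|F i| <= k) -> #|\bigcup_(i | P i) F i| <= #|P| * k.
Proof.
move=> Fk; rewrite -sum_nat_const; apply: (@leq_trans (\sum_(i | P i) #|F i|)).
  elim/big_rec2: _ => [|i x A Pi le]; first by rewrite cards0.
  by apply: leq_trans (leq_card_setU _ _) _; rewrite leq_add2l.
exact: leq_sum.
Qed.

Lemma sum_eq_le1 (T : finType) (Z : {set T}) (v : T) :
  \sum_(w in Z) (v == w : nat) = (v \in Z).
Proof.
have [vZ|vZ] := boolP (v \in Z).
  by rewrite (bigD1 v) //= eqxx big1 ?addn0 // => w /andP[_ /negPf]; rewrite eq_sym => ->.
by apply: big1 => w wZ; case: eqP => // e; rewrite e wZ in vZ.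
Qed.

(** * Guessing the graph from partially coloured vertices *)

Section Guess.
Variables (n K s : nat) (G' : rel 'I_n) (kap : 'I_n -> nat).

(* Colour [0] means uncoloured, colour [c.+1] stands for the part [c]. *)
Definition cls (c : nat) : {set 'I_n} := [set v | kap v == c.+1].

Definition represented (c : nat) : bool := s <= #|cls c|.

Definition majority (v : 'I_n) (c : nat) : bool :=
  #|cls c| < 2 * deg G' (cls c) v.

Definition dense (c c' : nat) : bool :=
  #|cls c| * #|cls c'| < 2 * pairs G' (cls c) (cls c').

Definition fits (v : 'I_n) (c : nat) : bool := represented c &&
  [forall c' : 'I_K, represented c' ==> (majority v c' == dense c c')].

Definition typical (v : 'I_n) : bool := [exists c : 'I_K, fits v c].

Definition pat : rel 'I_n := fun v w =>
  [exists c : 'I_K, exists c' : 'I_K, [&& fits v c, fits w c' & dense c c']].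

Definition guess : rel 'I_n := fun v w => (v != w) && (G' v w (+) pat v w).

Hypothesis symG' : symmetric G'.

Lemma denseC c c' : dense c c' = dense c' c.
Proof. by rewrite /dense mulnC pairsC. Qed.

Lemma patC : symmetric pat.
Proof.
have half v w : pat v w -> pat w v.
  move=> /existsP[c /existsP[c' /and3P[f f' e]]].
  by apply/existsP; exists c'; apply/existsP; exists c; rewrite f f' denseC.
by move=> v w; apply/idP/idP; apply: half.
Qed.

Lemma guess_sym : symmetric guess.
Proof. by move=> v w; rewrite /guess eq_sym symG' patC. Qed.

Lemma guess_irr : irreflexive guess.
Proof. by move=> v; rewrite /guess eqxx. Qed.

Lemma fits_rep v c : fits v c -> represented c.
Proof. by case/andP. Qed.

Lemma fitsP v c (c' : 'I_K) : fits v c -> represented c' -> majority v c' = dense c c'.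
Proof. by case/andP=> _ /forallP/(_ c')/implyP H /H/eqP. Qed.

(** A vertex may fit several parts, but the choice is immaterial: [v] has one majority towards [c'],
    so [c] can be exchanged for [e], and then [c'] for [e'] by looking from [w] at [e]. *)
Lemma patE v w (c c' : 'I_K) : fits v c -> fits w c' -> pat v w = dense c c'.
Proof.
move=> f f'; apply/idP/idP => [|e]; last first.
  by apply/existsP; exists c; apply/existsP; exists c'; rewrite f f' e.
case/existsP=> e /existsP[e' /and3P[fe fe' eE]].
rewrite -(fitsP f (fits_rep f')) (fitsP fe (fits_rep f')) denseC.
by rewrite -(fitsP f' (fits_rep fe)) (fitsP fe' (fits_rep fe)) denseC.
Qed.

Variables (d : nat) (G : rel 'I_n) (R : rel 'I_K) (part : 'I_n -> 'I_K).
Hypotheses (irrG : irreflexive G) (symR : symmetric R).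
Hypothesis G'E : forall v w, G' v w = (v != w) && (G v w (+) R (part v) (part w)).
Hypothesis sparseG : sparse d G setT.

(* A cell is a set of vertices of the same part and class.  A wrong pair of
   vertices from two large cells makes all pairs between these cells wrong,
   hence edges of [G] or [guess], contradicting sparsity. *)
Lemma guess_agree dp (Y : {set 'I_n}) :
  {in Y, forall v, typical v} -> sparse dp guess Y ->
  exists2 U : {set 'I_n}, #|U| <= K * K * (2 * (d + dp) + 1) &
    forall v w, v \in Y -> w \in Y -> v \notin U -> w \notin U ->
      guess v w = G v w.
Proof.
move=> typY spY; set t := 2 * (d + dp) + 1.
(* The default [part v] is never reached on [Y], whose vertices are typical. *)
pose cl v := if [pick c : 'I_K | fits v c] is Some c then c else part v.
have clP v : v \in Y -> fits v (cl v).
  move=> /typY /existsP[c fc]; rewrite /cl; case: pickP => // /(_ c).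
  by rewrite fc.
pose blk p := [set v in Y | (part v, cl v) == p].
pose U := \bigcup_(p | #|blk p| <= t) blk p.
exists U => [|v w vY wY vU wU].
  apply: leq_trans (card_bigcup_le (k := t) _) _ => //.
  by rewrite leq_mul2r (leq_trans (max_card _)) ?orbT // card_prod !card_ord.
set A := blk (part v, cl v); set B := blk (part w, cl w).
have big u : u \in Y -> u \notin U -> t < #|blk (part u, cl u)|.
  move=> uY; rewrite ltnNge; apply: contra => le.
  by apply/bigcupP; exists (part u, cl u); rewrite // inE uY eqxx.
have := big _ vY vU; have := big _ wY wU; rewrite -/A -/B => tB tA.
apply/eqP; apply: contraT => neq.
have patR : pat v w != R (part v) (part w).
  apply: contra neq => /eqP e; rewrite /guess e G'E.
  by case: (eqVneq v w) => [->|_] /=; rewrite ?irrG // -addbA addbb addbF.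
(* [guess] and [G] arise from [G'] by opposite toggles here, so exactly one of them holds off the
   diagonal; the last summand pays for the diagonal. *)
have wrong v' w' : v' \in A -> w' \in B -> 0 < guess v' w' + G v' w' + (v' == w').
  rewrite !inE => /andP[v'Y /eqP[pv cv]] /andP[w'Y /eqP[pw cw]].
  have e : pat v' w' = pat v w.
    by rewrite (patE (clP _ v'Y) (clP _ w'Y)) cv cw (patE (clP _ vY) (clP _ wY)).
  rewrite /guess e G'E pv pw; case: (v' == w') => //=; rewrite ?addn1 //=.
  by move: patR; case: (pat v w); case: (R _ _); case: (G v' w').
have sA : A \subset Y by apply/subsetP=> u; rewrite inE => /andP[].
have sB : B \subset Y by apply/subsetP=> u; rewrite inE => /andP[].
have : #|A| * #|B| <= pairs guess A B + pairs G A B + #|A|.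
  rewrite -sum_nat_const -[X in _ + X]sum1_card -!big_split /=.
  apply: leq_sum => v' v'A.
  rewrite -sum1_card.
  apply: leq_trans (_ : \sum_(w' in B) (guess v' w' + G v' w' + (v' == w')) <= _).
    by apply: leq_sum => w' w'B; apply: wrong.
  by rewrite !big_split /= leq_add2l sum_eq_le1; case: (_ \in _).
have := spY A B sA sB; have := sparseG (subsetT A) (subsetT B).
move: tA tB; rewrite /t; move: #|A| #|B| (pairs _ _ _) (pairs _ _ _).
clear => a b p q tA tB hq hp h.
have hA : (2 * (d + dp) + 2) * b <= a * b by rewrite leq_mul2r; apply/orP; right; lia.
have hB : (2 * (d + dp) + 2) * a <= b * a by rewrite leq_mul2r; apply/orP; right; lia.
nia.
Qed.

Hypothesis sE : s = 4 * d + 4.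
Hypothesis honest : forall v, kap v != 0 -> kap v = (part v).+1.

Lemma cls_part (c : 'I_K) v : v \in cls c -> part v = c.
Proof.
rewrite inE => /eqP e; apply: val_inj => /=.
by have := @honest v; rewrite e => /(_ isT) [].
Qed.

Lemma deg_complement (c : 'I_K) v : deg G' (cls c) v =
  if R (part v) c then #|cls c| - (deg G (cls c) v + (v \in cls c))
  else deg G (cls c) v.
Proof.
case: ifP => Rc; last first.
  apply: eq_bigr => w wc; rewrite G'E (cls_part wc) Rc addbF.
  by case: eqP => // ->; rewrite irrG.
rewrite -sum1_card -(sum_eq_le1 (cls c)) -big_split /= -sumnB => [|w _].
  apply: eq_bigr => w wc; rewrite G'E (cls_part wc) Rc addbT.
  by case: eqP => [->|_] /=; rewrite ?irrG //; case: (G v w).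
by case: eqP => [->|_] /=; rewrite ?irrG //; case: (G v w).
Qed.

(* The vertices whose majority adjacency to some represented part may differ
   from the pattern. *)
Definition abnormal : {set 'I_n} := \bigcup_(c : 'I_K | represented c)
  [set v | #|cls c| <= 2 * deg G (cls c) v + 2].

Lemma card_abnormal : #|abnormal| <= 4 * d * K.
Proof.
apply: leq_trans (card_bigcup_le (k := 4 * d) _) _ => [c rc|].
  apply: (sparse_high (X := cls c) sparseG); first by rewrite -sE.
  by move=> v; rewrite inE.
by rewrite mulnC leq_mul2l (leq_trans (max_card _)) ?orbT // card_ord.
Qed.

(** The slack [+ 2] in [abnormal] absorbs the vertex [v] itself, which complementing does not join
    to itself. *)
Lemma majority_part v (c : 'I_K) : v \notin abnormal -> represented c ->
  majority v c = R (part v) c.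
Proof.
move=> vA rc.
have {vA} : 2 * deg G (cls c) v + 2 < #|cls c|.
  rewrite ltnNge; apply: contra vA => le.
  by apply/bigcupP; exists c; rewrite ?inE.
rewrite /majority deg_complement; case: ifP => _; case: (v \in cls c); lia.
Qed.

(** Both classes have at least [4 * d + 4] vertices, so the edges of [G] fill less than half of the
    product, even after adding [#|cls c|] for the diagonal in case [c = c']. *)
Lemma dense_part (c c' : 'I_K) :
  represented c -> represented c' -> dense c c' = R c c'.
Proof.
move=> rc rc'; have := sparseG (subsetT (cls c)) (subsetT (cls c')).
have : s <= #|cls c'| := rc'; have : s <= #|cls c| := rc; rewrite sE => sc sc'.
have h1 : (4 * d + 4) * #|cls c'| <= #|cls c| * #|cls c'| by rewrite leq_mul2r sc orbT.
have h2 : (4 * d + 4) * #|cls c| <= #|cls c| * #|cls c'|.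
  by rewrite [X in _ <= X]mulnC leq_mul2r sc' orbT.
rewrite /dense => sp; case: (boolP (R c c')) => Rc; last first.
  rewrite (_ : pairs G' _ _ = pairs G (cls c) (cls c')).
    apply/negbTE; rewrite -leqNgt; move: sc sp h1 h2.
    by move: #|_| #|_| (pairs _ _ _) => a b p; nia.
  apply: eq_bigr => v vc; rewrite -!/(deg _ _ _).
  by rewrite deg_complement (cls_part vc) (negPf Rc).
have : #|cls c| * #|cls c'| <=
    pairs G' (cls c) (cls c') + pairs G (cls c) (cls c') + #|cls c|; last first.
  move: sc sc' sp h1 h2.
  by move: #|_| #|_| (pairs _ _ _) (pairs _ _ _) => a b p q; nia.
rewrite -sum_nat_const -[X in _ + X]sum1_card -!big_split /=.
apply: leq_sum => v vc; rewrite -!/(deg _ _ _) deg_complement (cls_part vc) Rc.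
by move: #|_| (deg _ _ _) => a b; case: (v \in cls c'); clear; lia.
Qed.

Lemma fits_part v : v \notin abnormal -> represented (part v) -> fits v (part v).
Proof.
move=> vA rv; rewrite /fits rv; apply/forallP => c; apply/implyP => rc.
by rewrite majority_part // dense_part.
Qed.

(** One represented part is enough. Even if [w] fits a foreign part [c], [dense c (part v)] is the
    majority of [w] towards the part of [v], and this is what [R] prescribes for a normal [w]. *)
Lemma guess_correct v w : v \notin abnormal -> w \notin abnormal ->
  represented (part v) -> typical w -> guess v w = G v w.
Proof.
move=> vA wA rv /existsP[c fw]; rewrite /guess G'E.
have rc := fits_rep fw.
rewrite (patE (fits_part vA rv) fw) denseC -(fitsP fw rv) majority_part //.
by rewrite symR; case: eqP => [->|_] /=; rewrite ?irrG // -addbA addbb addbF.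
Qed.

End Guess.

(** * Constants, prefixes and the progress made by a batch *)

Definition seed_size (d : nat) : nat := 4 * d + 4.
(** The abnormal vertices, plus [seed_size] vertices for each part still unrepresented. *)
Definition junk_bound (d K : nat) : nat := 4 * d * K + K * seed_size d.
(** Just enough for the edge count of a core in [batch_progress]: twice [d] for [G], twice
    [junk_bound] for few exceptional vertices, twice one for covering vertices of low degree. *)
Definition core_deg (d K : nat) : nat := 2 * (d + junk_bound d K + 1).
Definition agree_bound (d K : nat) : nat := K * K * (2 * (d + core_deg d K) + 1).
(** The extra unit is the last vertex of the failing prefix, added to the cover of the wrong
    pairs. *)
Definition hub_ratio (d K : nat) : nat := agree_bound d K + 1.
Definition batch_size (d K : nat) : nat :=
  junk_bound d K + 1 + hub_ratio d K * (2 * core_deg d K + 2).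

Section Prefixes.
Variables (n K d : nat) (G' : rel 'I_n) (kap : 'I_n -> nat).

Notation typ := (typical K (seed_size d) G' kap).
Notation gue := (guess K (seed_size d) G' kap).

Definition typ_prefix (i : nat) : {set 'I_n} := [set v : 'I_n | (v <= i) && typ v].
Definition junk_prefix (i : nat) : {set 'I_n} := [set v : 'I_n | (v <= i) && ~~ typ v].
Definition core_prefix (i : nat) : {set 'I_n} := core (core_deg d K) gue (typ_prefix i).
Definition hubs (i : nat) : {set 'I_n} := [set v in core_prefix i |
  #|core_prefix i| <= hub_ratio d K * deg gue (core_prefix i) v].
Definition fails (i : nat) : bool :=
  (core_prefix i != set0) || (junk_bound d K < #|junk_prefix i|).
Definition batch (i : nat) : {set 'I_n} := junk_prefix i :|: hubs i.

Definition accepted : Prop := forall i : 'I_n, ~~ fails i.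
Definition first_fail (i : 'I_n) : Prop :=
  fails i /\ forall j : 'I_n, j < i -> ~~ fails j.

Lemma accepted_or_fail : accepted \/ exists i, first_fail i.
Proof.
case: (pickP (fun i : 'I_n => fails i)) => [i0 fi0|no]; last by left=> i; rewrite no.
right; 
case: (@arg_minnP _ i0 (fun i : 'I_n => fails i) (fun i => val i) fi0) => i fi mi.
by exists i; split=> // j; rewrite ltnNge; apply: contra => /mi.
Qed.

Lemma first_fail_uniq i j : first_fail i -> first_fail j -> i = j.
Proof.
move=> [fi mi] [fj mj]; apply: val_inj; case: (ltngtP (val i) (val j)) => // lt.
  by have := mj i lt; rewrite fi.
by have := mi j lt; rewrite fj.
Qed.

Hypothesis symG' : symmetric G'.

Lemma ok_prefix (i : 'I_n) : ~~ fails i ->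
  sparse (core_deg d K) gue (typ_prefix i) /\ #|junk_prefix i| <= junk_bound d K.
Proof.
rewrite negb_or negbK -leqNgt => /andP[/eqP c0 le]; split=> //.
exact: core0_sparse (guess_sym _ _ _ symG') c0.
Qed.

(** Typicality does not depend on the prefix, so deleting [i] from prefix [i] leaves a subset of the
    previous prefix, which passed the test by minimality; for [i = 0] nothing is left. *)
Lemma before_fail (i : 'I_n) : first_fail i ->
  sparse (core_deg d K) gue (typ_prefix i :\ i) /\
  #|junk_prefix i :\ i| <= junk_bound d K.
Proof.
move=> [_ mi]; have [i0|i_gt0] := posnP (val i).
  have z (P : pred 'I_n) : [set v : 'I_n | (v <= i) && P v] :\ i = set0.
    apply/setP=> v; rewrite !inE i0 leqn0; apply/negbTE/negP => /and3P[vi /eqP v0 _].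
    by case/eqP: vi; apply: val_inj; rewrite /= v0 i0.
  have -> : junk_prefix i :\ i = set0 by apply: (z (fun v => ~~ typ v)).
  have -> : typ_prefix i :\ i = set0 by apply: z.
  rewrite cards0; split=> // X Y.
  by rewrite !subset0 => /eqP -> _; rewrite /pairs big_set0.
have kn : i.-1 < n by apply: leq_ltn_trans (leq_pred i) _.
have [|sp le] := @ok_prefix (Ordinal kn); first by apply: mi; rewrite /= prednK.
have sub (P : pred 'I_n) : [set v : 'I_n | (v <= i) && P v] :\ i
    \subset [set v : 'I_n | (v <= Ordinal kn) && P v].
  apply/subsetP=> v; rewrite !inE /= => /and3P[vi le' ->]; rewrite andbT.
  have : val v != val i by [].
  by move: i_gt0 le' => /=; lia.
split; first exact: sparse_sub (sub typ) sp.
exact: leq_trans (subset_leq_card (sub (fun v => ~~ typ v))) le.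
Qed.

(** Without [i] the core is sparse, and [i] adds at most two pairs per vertex; a linear number of
    pairs leaves room for boundedly many vertices of linear degree. *)
Lemma card_hubs (i : 'I_n) : first_fail i ->
  #|hubs i| <= hub_ratio d K * (2 * core_deg d K + 2).
Proof.
move=> ff; have [sp _] := before_fail ff; set C := core_prefix i.
have [C0|Cn0] := eqVneq C set0.
  rewrite /hubs -/C C0 (_ : [set _ in _ | _] = set0) ?cards0 //.
  by apply/setP=> v; rewrite !inE.
have hC : pairs gue C C <= (2 * core_deg d K + 2) * #|C|.
  have sgue := guess_sym K (seed_size d) kap symG'.
  have CY : C :\ i \subset typ_prefix i :\ i by apply/setSD/core_sub.
  have := sp _ _ CY CY; set D := C :\ i => spD.
  have DC : #|D| <= #|C| by rewrite subset_leq_card ?subD1set.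
  have step W : pairs gue C W <= #|W| + pairs gue D W.
    case: (boolP (i \in C)) => iC.
      by rewrite (pairsD1 _ _ iC) leq_add2r deg_le_card.
    rewrite (_ : D = C) ?leq_addl //; apply/setP=> u; rewrite !inE.
    by case: eqP => //= ->; rewrite (negPf iC).
  have := step C; have := step D; rewrite (pairsC _ _ sgue).
  move: spD DC; move: #|_| #|_| (pairs _ _ _) (pairs _ _ _) (pairs _ _ _).
  by move=> a b p q r; nia.
have C_gt0 : 0 < #|C| by rewrite card_gt0.
rewrite -(leq_pmul2r C_gt0) -mulnA.
apply: leq_trans (_ : hub_ratio d K * pairs gue C C <= _); last first.
  by rewrite leq_mul2l hC orbT.
rewrite -sum_nat_const /pairs big_distrr /=.
rewrite [X in _ <= X](bigID (mem (hubs i))) /=.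
apply: leq_trans (leq_addr _ _).
rewrite [X in _ <= X](eq_bigl (mem (hubs i))) /=; last first.
  by move=> v; rewrite !inE; case: (v \in C).
by apply: leq_sum => v; rewrite inE => /andP[].
Qed.

Lemma card_batch (i : 'I_n) : first_fail i -> #|batch i| <= batch_size d K.
Proof.
move=> ff; apply: leq_trans (leq_card_setU _ _) _.
apply: leq_add (card_hubs ff); have [_ le] := before_fail ff.
by rewrite (cardsD1 i) addnC leq_add // leq_b1.
Qed.

Variables (G : rel 'I_n) (R : rel 'I_K) (part : 'I_n -> 'I_K).
Hypotheses (symG : symmetric G) (irrG : irreflexive G) (symR : symmetric R).
Hypothesis G'E : forall v w, G' v w = (v != w) && (G v w (+) R (part v) (part w)).
Hypothesis sparseG : sparse d G setT.

(** The last prefix is the whole vertex set; the untypical vertices join the exceptional set of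
    [guess_agree]. The colouring is arbitrary, so any accepted guess is good. *)
Lemma accepted_agree : accepted ->
  exists2 U : {set 'I_n}, #|U| <= agree_bound d K + junk_bound d K &
    forall v w, v \notin U -> w \notin U -> G v w = gue v w.
Proof.
move=> acc; set Y := [set v | typ v].
have [spY leS] : sparse (core_deg d K) gue Y /\ #|~: Y| <= junk_bound d K.
  have [n0|n_gt0] := posnP n.
    have z (Z : {set 'I_n}) : Z = set0.
      by apply/setP=> v; have := ltn_ord v; rewrite {2}n0.
    by split=> [X X' _ _|]; rewrite ?(z (~: _)) ?cards0 // (z X) /pairs big_set0.
  have ltn : n.-1 < n by rewrite prednK.
  have [sp le] := ok_prefix (acc (Ordinal ltn)).
  suff [-> ->] : Y = typ_prefix n.-1 /\ ~: Y = junk_prefix n.-1 by [].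
  by split; apply/setP=> v; rewrite !inE -ltnS prednK ?ltn_ord.
have [|U leU eqU] := guess_agree symG' irrG G'E sparseG _ spY.
  by move=> v; rewrite inE.
exists (U :|: ~: Y) => [|v w].
  by apply: leq_trans (leq_card_setU _ _) _; apply: leq_add.
by rewrite !inE !negb_or !negbK => /andP[vU vY] /andP[wU wY]; rewrite eqU ?inE.
Qed.

Hypothesis honest : forall v, kap v != 0 -> kap v = (part v).+1.

Notation rep := (represented (seed_size d) kap).

(** Otherwise the batch has few vertices in unrepresented parts. Then too few vertices can be
    untypical, and the guessed edges of the core are too few for its minimum degree, so the prefix
    would not fail. *)
Lemma batch_progress (i : 'I_n) : first_fail i -> exists c : 'I_K,
  ~~ rep c /\ seed_size d <= #|[set v in batch i | part v == c]|.
Proof.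
move=> ff; suff /existsP[c /andP[nc lec]] : [exists c : 'I_K, ~~ rep c &&
    (seed_size d <= #|[set v in batch i | part v == c]|)] by exists c.
apply: contraT; rewrite negb_exists => /forallP no.
pose N := [set v | ~~ rep (part v)].
set A := abnormal K (seed_size d) kap G.
have cA : #|A| <= 4 * d * K by apply: (card_abnormal _ _ sparseG).
have few : #|batch i :&: N| <= K * seed_size d.
  apply: leq_trans (_ : #|\bigcup_(c : 'I_K | ~~ rep c)
      [set v in batch i | part v == c]| <= _).
    apply/subset_leq_card/subsetP=> v; rewrite inE => /andP[vb]; rewrite inE => vN.
    by apply/bigcupP; exists (part v); rewrite // inE vb eqxx.
  apply: leq_trans (card_bigcup_le (k := seed_size d) _) _ => [c rc|].
    by have := no c; rewrite rc -ltnNge => /ltnW.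
  by rewrite leq_mul2r (leq_trans (max_card _)) ?orbT // card_ord.
have fitsA v : v \notin A -> rep (part v) -> fits K (seed_size d) G' kap v (part v).
  by move=> vA rv; apply: (fits_part irrG G'E sparseG).
have [fi _] := ff; have [spY leS] := before_fail ff.
case/orP: fi => [Cn0|]; last first.
  (* Too many untypical vertices: each is abnormal or in an unrepresented part, since a normal
     vertex of a represented part fits that part. *)
  apply: contraLR => _; rewrite -leqNgt.
  apply: leq_trans (_ : #|A :|: (batch i :&: N)| <= _); last first.
    by apply: leq_trans (leq_card_setU _ _) _; apply: leq_add.
  apply/subset_leq_card/subsetP=> v vS; rewrite inE; case: (boolP (v \in A)) => //= vA.
  rewrite !inE; move: vS; rewrite !inE => /andP[-> vt] /=; rewrite vt /=.
  by apply: contra vt => rv; apply/existsP; exists (part v); apply: fitsA.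
set C := core_prefix i in Cn0 *; have C_gt0 : 0 < #|C| by rewrite card_gt0.
have CY : C \subset typ_prefix i by apply: core_sub.
have typC v : v \in C -> typ v by move=> /(subsetP CY); rewrite inE => /andP[].
have [|U leU eqU] := guess_agree symG' irrG G'E sparseG _ spY.
  by move=> v; rewrite !inE => /and3P[].
(* [i |: U] covers the remaining wrong pairs. Its hubs belong to the batch and are counted in [DU];
   [X] keeps the vertices of low degree. *)
pose DU := batch i :&: N; pose X := (i |: U) :\: hubs i.
have sgue := guess_sym K (seed_size d) kap symG'.
(* A guessed edge missing from [G] is charged to an end. With both ends normal, both lie in
   unrepresented parts by [guess_correct]. Vertices of [X] are charged only for their guessed
   edges. *)
have wrong v w : v \in C -> w \in C -> gue v w <= G v w +
    ((v \in A) + (v \in DU) + (v \in X) * gue v w) +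
    ((w \in A) + (w \in DU) + (w \in X) * gue v w).
  move=> vC wC; case: (boolP (gue v w)) => // gvw.
  case: (boolP (G v w)) => //= Gvw.
  case: (boolP (v \in A)) => [_|vA]; first by rewrite !addn_gt0 /= ?orbT.
  case: (boolP (w \in A)) => [_|wA]; first by rewrite !addn_gt0 /= ?orbT.
  have eqrep u u' : gue u u' != G u u' -> u \notin A -> u' \notin A ->
      u' \in C -> u \in N.
    move=> neq uA u'A u'C; rewrite inE; apply: contra neq => ru.
    apply/eqP; apply: (guess_correct symG' irrG symR G'E sparseG erefl honest) => //.
    exact: typC.
  have neq : gue v w != G v w by rewrite gvw (negPf Gvw).
  have neq' : gue w v != G w v by rewrite sgue symG.
  have vN := eqrep _ _ neq vA wA wC; have wN := eqrep _ _ neq' wA vA vC.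
  case: (boolP (v \in hubs i)) => vh.
    by rewrite [v \in DU]in_setI vN [v \in batch i]in_setU vh !addn_gt0 /= ?orbT.
  case: (boolP (w \in hubs i)) => wh.
    by rewrite [w \in DU]in_setI wN [w \in batch i]in_setU wh !addn_gt0 /= ?orbT.
  rewrite [v \in X]in_setD vh [w \in X]in_setD wh /= !muln1 !in_setU1.
  case: (eqVneq v i) => [_|vi] /=; first by rewrite !addn_gt0 /= ?orbT.
  case: (eqVneq w i) => [_|wi] /=; first by rewrite !addn_gt0 /= ?orbT.
  case: (boolP (v \in U)) => vU; first by rewrite !addn_gt0 /= ?orbT.
  case: (boolP (w \in U)) => wU; first by rewrite !addn_gt0 /= ?orbT.
  case/eqP: neq; apply: eqU => //; rewrite in_setD1 ?vi ?wi /=.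
    exact: (subsetP CY).
  exact: (subsetP CY).
have sumb (Z : {set 'I_n}) k : #|Z| <= k -> \sum_(v in C) (v \in Z) <= k.
  move=> le; rewrite sum_boolE; apply: leq_trans le; apply/subset_leq_card/subsetP=> v.
  by rewrite inE => /andP[].
(* At most [hub_ratio] vertices, each of degree below [#|C|] divided by [hub_ratio]. *)
have hX : \sum_(v in C) (v \in X) * deg gue C v <= #|C|.
  have M0 : 0 < hub_ratio d K by rewrite /hub_ratio addn1.
  rewrite -(leq_pmul2l M0) big_distrr /=.
  have cX : #|X| <= hub_ratio d K.
    apply: leq_trans (subset_leq_card (subsetDl _ _)) _.
    by rewrite cardsU1 /hub_ratio addnC leq_add // leq_b1.
  apply: leq_trans (_ : \sum_(v in C) (v \in X) * #|C| <= _).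
    apply: leq_sum => v vC; case: (boolP (v \in X)); last by rewrite mul0n muln0.
    rewrite !mul1n inE => /andP[]; rewrite inE vC /= -ltnNge => /ltnW //.
  rewrite -big_distrl /=; by rewrite leq_mul2r sumb ?orbT.
have lower : (core_deg d K).+1 * #|C| <= pairs gue C C.
  rewrite mulnC -sum_nat_const; apply: leq_sum => v vC.
  by have /forall_inP/(_ v vC) := stable_core (core_deg d K) gue (typ_prefix i).
have upper : pairs gue C C <= pairs G C C +
    2 * ((4 * d * K + K * seed_size d) * #|C| + #|C|).
  pose f v w := (v \in A) + (v \in DU) + (v \in X) * gue v w.
  have hf : \sum_(v in C) \sum_(w in C) f v w <=
      (4 * d * K + K * seed_size d) * #|C| + #|C|.
    rewrite /f; under eq_bigr => v _.
      rewrite big_split /= sum_nat_const -big_distrr /= -/(deg gue C v). over.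
    rewrite big_split /= leq_add // -big_distrr /= mulnC leq_mul2r big_split /=.
    by rewrite leq_add ?orbT // sumb.
  apply: leq_trans (_ : \sum_(v in C) \sum_(w in C) (G v w + f v w + f w v) <= _).
    apply: leq_sum => v vC; apply: leq_sum => w wC.
    by rewrite /f (sgue w v); apply: wrong.
  move: f hf => f hf; under eq_bigr => v _ do rewrite !big_split /=.
  rewrite !big_split /= [X in _ + X <= _]exchange_big /= -/(pairs G C C).
  by rewrite mul2n -addnn addnA leq_add // leq_add2l.
(* Per vertex of the core, the lower count is [2 * d + 2 * r + 3] and the upper one
   [2 * d + 2 * r + 2], with [r] standing for [junk_bound]. *)
have := sparseG (subsetT C) (subsetT C); move: lower upper C_gt0.
rewrite /core_deg /junk_bound; move: #|_| (pairs _ _ _) (pairs _ _ _) (4 * d * K + _).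
move=> a p q r lower upper a_gt0 sp.
have : (2 * d + 2 * r + 3) * a <= (2 * d + 2 * r + 2) * a.
  by clear - lower upper sp; lia.
by rewrite leq_pmul2r //; clear; lia.
Qed.
End Prefixes.

(** * A language of bounded loops *)

Inductive hexpr : Type :=
  | HC of nat
  | HV of nat
  | HGet of nat & hexpr
  | HAdd of hexpr & hexpr
  | HSub of hexpr & hexpr
  | HSum of nat & hexpr & hexpr.

Inductive hcmd : Type :=
  | HAssign of nat & hexpr
  | HStore of nat & hexpr & hexpr
  | HSeq of hcmd & hcmd
  | HIf of hexpr & hcmd & hcmd
  | HFor of nat & hexpr & hcmd.

Fixpoint heval (m : state) (e : hexpr) : nat :=
  match e with
  | HC k => k
  | HV x => regs m x
  | HGet a e1 => arrs m a (heval m e1)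
  | HAdd e1 e2 => heval m e1 + heval m e2
  | HSub e1 e2 => heval m e1 - heval m e2
  | HSum x b e1 => \sum_(i < heval m b) heval (set_reg m x i) e1
  end.

(** A loop evaluates its bound once, on entry, and sets its variable anew in each iteration; hence
    every program halts and denotes a function on states. *)
Fixpoint hrun (c : hcmd) (m : state) : state :=
  match c with
  | HAssign x e => set_reg m x (heval m e)
  | HStore a e1 e2 => set_cell m a (heval m e1) (heval m e2)
  | HSeq c1 c2 => hrun c2 (hrun c1 m)
  | HIf e c1 c2 => if heval m e != 0 then hrun c1 m else hrun c2 m
  | HFor x b c1 => iteri (heval m b) (fun i m' => hrun c1 (set_reg m' x i)) m
  end.

(* [ecode sg k e] leaves the value of [e] in register [k] and writes only
   registers from [k] on; [sg] locates the variables, those bound by [HSum]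
   being moved to fresh registers. *)
Fixpoint ecode (sg : nat -> nat) (k : nat) (e : hexpr) : cmd :=
  match e with
  | HC c => Assign k (Cst c)
  | HV x => Assign k (Reg (sg x))
  | HGet a e1 => Seq (ecode sg k e1) (Assign k (Get a (Reg k)))
  | HAdd e1 e2 => Seq (ecode sg k e1)
      (Seq (ecode sg k.+1 e2) (Assign k (Add (Reg k) (Reg k.+1))))
  | HSub e1 e2 => Seq (ecode sg k e1)
      (Seq (ecode sg k.+1 e2) (Assign k (Defs.Sub (Reg k) (Reg k.+1))))
  | HSum x b e1 => Seq (ecode sg k.+1 b)
      (Seq (Assign k.+2 (Cst 0)) (Seq (Assign k (Cst 0))
        (WhileNZ (Defs.Sub (Reg k.+1) (Reg k.+2))
          (Seq (ecode (fun y => if y == x then k.+2 else sg y) k.+3 e1)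
            (Seq (Assign k (Add (Reg k) (Reg k.+3)))
               (Assign k.+2 (Add (Reg k.+2) (Cst 1))))))))
  end.

Fixpoint ecost (m : state) (e : hexpr) : nat :=
  match e with
  | HC _ => 1
  | HV _ => 1
  | HGet _ e1 => ecost m e1 + 1
  | HAdd e1 e2 => ecost m e1 + (ecost m e2 + 1)
  | HSub e1 e2 => ecost m e1 + (ecost m e2 + 1)
  | HSum x b e1 => ecost m b +
      (3 + \sum_(i < heval m b) (ecost (set_reg m x i) e1 + 3))
  end.

(** A loop keeps its bound in register [k] and its counter in [k.+1]; the temporaries of its body
    start at [k.+2]. *)
Fixpoint ccode (k : nat) (c : hcmd) : cmd :=
  match c with
  | HAssign x e => Seq (ecode id k e) (Assign x (Reg k))
  | HStore a e1 e2 => Seq (ecode id k e1)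
      (Seq (ecode id k.+1 e2) (Store a (Reg k) (Reg k.+1)))
  | HSeq c1 c2 => Seq (ccode k c1) (ccode k c2)
  | HIf e c1 c2 => Seq (ecode id k e) (IfNZ (Reg k) (ccode k c1) (ccode k c2))
  | HFor x b c1 => Seq (ecode id k b) (Seq (Assign k.+1 (Cst 0))
      (WhileNZ (Defs.Sub (Reg k) (Reg k.+1))
        (Seq (Assign x (Reg k.+1))
          (Seq (ccode k.+2 c1) (Assign k.+1 (Add (Reg k.+1) (Cst 1)))))))
  end.

Fixpoint ccost (m : state) (c : hcmd) : nat :=
  match c with
  | HAssign x e => ecost m e + 1
  | HStore a e1 e2 => ecost m e1 + (ecost m e2 + 1)
  | HSeq c1 c2 => ccost m c1 + ccost (hrun c1 m) c2
  | HIf e c1 c2 =>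
      ecost m e + (if heval m e != 0 then ccost m c1 else ccost m c2).+1
  | HFor x b c1 => ecost m b + (2 + \sum_(i < heval m b)
      (ccost (set_reg (iteri i (fun i m' => hrun c1 (set_reg m' x i)) m) x i)
         c1 + 3))
  end.

Fixpoint ewf (N : nat) (e : hexpr) : bool :=
  match e with
  | HC _ => true
  | HV x => x < N
  | HGet _ e1 => ewf N e1
  | HAdd e1 e2 => ewf N e1 && ewf N e2
  | HSub e1 e2 => ewf N e1 && ewf N e2
  | HSum x b e1 => [&& x < N, ewf N b & ewf N e1]
  end.

Fixpoint cwf (N : nat) (c : hcmd) : bool :=
  match c with
  | HAssign x e => (x < N) && ewf N e
  | HStore _ e1 e2 => ewf N e1 && ewf N e2
  | HSeq c1 c2 => cwf N c1 && cwf N c2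
  | HIf e c1 c2 => [&& ewf N e, cwf N c1 & cwf N c2]
  | HFor x b c1 => [&& x < N, ewf N b & cwf N c1]
  end.

(** * Correctness and exact cost of the translation *)

Definition esim (N : nat) (sg : nat -> nat) (k : nat) (s m : state) : Prop :=
  (forall x, x < N -> sg x < k /\ regs s (sg x) = regs m x) /\
  (forall a i, arrs s a i = arrs m a i).

(** The invariant is indexed by the iteration, so each iteration has its own exact cost; the outer
    [.+1] pays for the final failing test. *)
Lemma exec_while_sum (e : expr) (c : cmd) (n : nat) (t : nat -> nat)
    (I : nat -> state -> Prop) (s : state) :
  I 0 s ->
  (forall i s, i < n -> I i s -> eval s e != 0 /\
     exists2 s', exec c s s' (t i) & I i.+1 s') ->
  (forall s, I n s -> eval s e = 0) ->
  exists2 s', exec (WhileNZ e c) s s' (\sum_(i < n) (t i).+1).+1 & I n s'.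
Proof.
move=> I0 IS In.
suff H j i s1 : i + j = n -> I i s1 ->
    exists2 s', exec (WhileNZ e c) s1 s' (\sum_(i <= l < n) (t l).+1).+1 & I n s'.
  by have [s' E P] := H n 0 s erefl I0; exists s' => //; rewrite big_mkord in E.
elim: j i s1 => [|j IH] i s1 ij Ii.
  rewrite addn0 in ij; subst i; exists s1 => //.
  by rewrite big_geq //; apply/exec_while_end/In.
have lt_in : i < n by lia.
have [nz [s2 E2 I2]] := IS _ _ lt_in Ii.
have [|s3 E3 I3] := IH i.+1 s2 _ I2; first by lia.
exists s3 => //; rewrite big_ltn //.
have -> : (((t i).+1 + \sum_(i.+1 <= l < n) (t l).+1).+1) =
  (t i + (\sum_(i.+1 <= l < n) (t l).+1).+1).+1 by lia.
exact: exec_while_loop E2 E3.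
Qed.

Ltac decide_eqn := repeat match goal with |- context [@eq_op _ ?a ?b] =>
  first [ rewrite (_ : (a == b) = false); last by clear; lia
        | rewrite (_ : (a == b) = true); last by clear; lia
        | rewrite (_ : (a == b) = false); last by lia ] end.

Lemma ecodeP N e sg k s m : ewf N e -> esim N sg k s m ->
  exists2 s', exec (ecode sg k e) s s' (ecost m e) &
    [/\ regs s' k = heval m e, forall x, x < k -> regs s' x = regs s x &
        forall a i, arrs s' a i = arrs s a i].
Proof.
have esimS sg' k' k1 s1 s2 m1 : esim N sg' k' s1 m1 -> k' <= k1 ->
    (forall x, x < k' -> regs s2 x = regs s1 x) ->
    (forall a i, arrs s2 a i = arrs s1 a i) -> esim N sg' k1 s2 m1.
  move=> [S1 S2] kk E1 E2; split=> [x xN|a i]; last by rewrite E2.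
  have [lt <-] := S1 x xN; split; first exact: leq_trans lt kk.
  exact: E1.
elim: e sg k s m => [c|x|a e IH|e1 IH1 e2 IH2|e1 IH1 e2 IH2|x b IHb e IH]
  sg k s m /=.
- move=> _ _; eexists; first exact: exec_assign.
  by split=> //= [|y yk]; rewrite ?eqxx // ltn_eqF.
- move=> xN [S1 S2]; eexists; first exact: exec_assign.
  by split=> //= [|y yk]; rewrite ?eqxx ?ltn_eqF //; apply: (S1 x xN).2.
- move=> we S; have [s1 E1 [r1 f1 a1]] := IH _ _ _ _ we S.
  eexists; first exact: exec_seq E1 (exec_assign _ _ _).
  split=> //= [|y yk]; last by rewrite ltn_eqF // f1.
  by rewrite eqxx r1 a1 S.2.
- move=> /andP[w1 w2] S; have [s1 E1 [r1 f1 a1]] := IH1 _ _ _ _ w1 S.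
  have S' := esimS _ _ _ _ _ _ S (leqnSn k) f1 a1.
  have [s2 E2 [r2 f2 a2]] := IH2 _ _ _ _ w2 S'.
  eexists; first exact: exec_seq E1 (exec_seq E2 (exec_assign _ _ _)).
  split=> [/=|y yk|] /=.
  + by rewrite eqxx r2 f2 // r1.
  + by rewrite ltn_eqF // f2 ?f1 //; lia.
  + by move=> c i; rewrite a2 a1.
- move=> /andP[w1 w2] S; have [s1 E1 [r1 f1 a1]] := IH1 _ _ _ _ w1 S.
  have S' := esimS _ _ _ _ _ _ S (leqnSn k) f1 a1.
  have [s2 E2 [r2 f2 a2]] := IH2 _ _ _ _ w2 S'.
  eexists; first exact: exec_seq E1 (exec_seq E2 (exec_assign _ _ _)).
  split=> [/=|y yk|] /=.
  + by rewrite eqxx r2 f2 // r1.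
  + by rewrite ltn_eqF // f2 ?f1 //; lia.
  + by move=> c i; rewrite a2 a1.
move=> /and3P[xN wb we] S.
have S0 : esim N sg k.+1 s m by apply: (esimS _ _ _ _ _ _ S).
have [s1 E1 [r1 f1 a1]] := IHb _ _ _ _ wb S0.
pose s2 := set_reg (set_reg s1 k.+2 0) k 0.
(* Register [k.+1] holds the bound, [k.+2] the index and [k] the partial sum. *)
pose I i s' := [/\ regs s' k.+1 = heval m b, regs s' k.+2 = i,
  regs s' k = \sum_(j < i) heval (set_reg m x j) e,
  (forall y, y < k -> regs s' y = regs s y) &
  forall c j, arrs s' c j = arrs s c j].
have I0 : I 0 s2.
  split=> /=; decide_eqn; rewrite ?big_ord0 //.
  by move=> y yk; decide_eqn; rewrite f1; lia.
have [i s' lt_i [j1 j2 j3 j4 j5]||s3 E3 [_ _ j3 j4 j5]] := @exec_while_sum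
   (Defs.Sub (Reg k.+1) (Reg k.+2))
   (Seq (ecode (fun y => if y == x then k.+2 else sg y) k.+3 e)
            (Seq (Assign k (Add (Reg k) (Reg k.+3)))
               (Assign k.+2 (Add (Reg k.+2) (Cst 1)))))
   (heval m b) (fun i => ecost (set_reg m x i) e + 2) I s2 I0.
- split; first by rewrite /= j1 j2; lia.
  have S' : esim N (fun y => if y == x then k.+2 else sg y) k.+3 s'
      (set_reg m x i).
    split=> [y yN|c j] /=; last by rewrite j5 S.2.
    have [//|_] := eqVneq y x; have [lt <-] := S.1 y yN.
    by split; [lia|apply: j4].
  have [s4 E4 [r4 f4 a4]] := IH _ _ _ _ we S'.
  eexists; first exact: exec_seq E4 (exec_seq (exec_assign _ _ _)
    (exec_assign _ _ _)).
  rewrite /I /= ?eqxx; split.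
  + by decide_eqn; rewrite f4.
  + by decide_eqn; rewrite f4 ?j2; lia.
  + by decide_eqn; rewrite big_ord_recr /= r4 f4 ?j3 //; lia.
  + by move=> y yk; decide_eqn; rewrite f4 ?j4; lia.
  + by move=> c j; rewrite a4 j5.
- by move=> s' [j1 j2 _ _ _]; rewrite /= j1 j2 subnn.
exists s3; last by split=> // c i.
have <- : 1 + (1 + (\sum_(i < heval m b) (ecost (set_reg m x i) e + 2).+1).+1)
  = 3 + \sum_(i < heval m b) (ecost (set_reg m x i) e + 3).
  by rewrite !addSn !add0n; do 3!congr _.+1; apply: eq_bigr => i _; lia.
exact: (exec_seq E1 (exec_seq (exec_assign s1 k.+2 (Cst 0))
  (exec_seq (exec_assign _ k (Cst 0)) E3))).
Qed.

(** The last clause protects the bounds and counters of the enclosing loops, which lie between the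
    variables and [k]. *)
Lemma ccodeP N c k s m : cwf N c -> N <= k -> esim N id k s m ->
  exists2 s', exec (ccode k c) s s' (ccost m c) &
    esim N id k s' (hrun c m) /\
    forall x, N <= x -> x < k -> regs s' x = regs s x.
Proof.
have esimS k0 k1 s1 s2 m1 : esim N id k0 s1 m1 -> k0 <= k1 ->
    (forall x, x < k0 -> regs s2 x = regs s1 x) ->
    (forall a i, arrs s2 a i = arrs s1 a i) -> esim N id k1 s2 m1.
  move=> [S1 S2] kk E1 E2; split=> [x xN|a i]; last by rewrite E2.
  have [lt <-] := S1 x xN; split; first exact: leq_trans lt kk.
  exact: E1.
elim: c k s m => [x e|a e1 e2|c1 IH1 c2 IH2|e c1 IH1 c2 IH2|x b c IH] k s m /=.
- move=> /andP[xN we] Nk S; have [s1 E1 [r1 f1 a1]] := ecodeP we S.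
  eexists; first exact: exec_seq E1 (exec_assign _ _ _).
  have [T1 T2] := esimS _ _ _ _ _ S (leqnn k) f1 a1.
  split; last by move=> y Ny yk /=; rewrite gtn_eqF ?f1 //; lia.
  split=> [y yN|//] /=; have [lt E] := T1 y yN; split=> //.
  by case: eqP => // _; rewrite r1.
- move=> /andP[w1 w2] Nk S; have [s1 E1 [r1 f1 a1]] := ecodeP w1 S.
  have S1 := esimS _ _ _ _ _ S (leqnSn k) f1 a1.
  have [s2 E2 [r2 f2 a2]] := ecodeP w2 S1.
  eexists; first exact: exec_seq E1 (exec_seq E2 (exec_store _ _ _ _)).
  have [T1 T2] := esimS _ _ _ _ _ S1 (leqnn _) f2 a2.
  split; last by move=> y Ny yk /=; rewrite f2 ?f1 //; lia.
  split=> [y yN|c i] /=; first by have [lt E] := T1 y yN; split=> //; lia.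
  by rewrite r2 f2 // r1 T2.
- move=> /andP[w1 w2] Nk S; have [s1 E1 [S1 f1]] := IH1 _ _ _ w1 Nk S.
  have [s2 E2 [S2 f2]] := IH2 _ _ _ w2 Nk S1.
  exists s2; first exact: exec_seq E1 E2.
  by split=> // x Nx xk; rewrite f2 ?f1.
- move=> /and3P[we w1 w2] Nk S; have [s1 E1 [r1 f1 a1]] := ecodeP we S.
  have S1 := esimS _ _ _ _ _ S (leqnn k) f1 a1.
  case: (boolP (heval m e != 0)) => [nz|/negPn/eqP z].
    have [s2 E2 [S2 f2]] := IH1 _ _ _ w1 Nk S1; exists s2.
      by apply: exec_seq E1 _; apply: exec_if_then E2; rewrite /= r1.
    by split=> // x Nx xk; rewrite f2 ?f1.
  have [s2 E2 [S2 f2]] := IH2 _ _ _ w2 Nk S1; exists s2.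
    by apply: exec_seq E1 _; apply: exec_if_else E2; rewrite /= r1.
  by split=> // x Nx xk; rewrite f2 ?f1.
move=> /and3P[xN wb wc] Nk S; have [s1 E1 [r1 f1 a1]] := ecodeP wb S.
pose M i := iteri i (fun i m' => hrun c (set_reg m' x i)) m.
pose I i s' := [/\ regs s' k = heval m b, regs s' k.+1 = i,
  esim N id k.+2 s' (M i) &
  forall y, N <= y -> y < k -> regs s' y = regs s y].
pose s2 := set_reg s1 k.+1 0.
have I0 : I 0 s2.
  split=> /=; decide_eqn => //; last first.
    by move=> y Ny yk; decide_eqn; rewrite f1.
  apply: (esimS k k.+2 s) => // [|y yk /=]; first by lia.
  by decide_eqn; apply: f1.
have [i s' lt_i [j1 j2 j3 j4]||s3 E3 [_ _ j3 j4]] := @exec_while_sum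
   (Defs.Sub (Reg k) (Reg k.+1))
   (Seq (Assign x (Reg k.+1))
          (Seq (ccode k.+2 c) (Assign k.+1 (Add (Reg k.+1) (Cst 1)))))
   (heval m b) (fun i => ccost (set_reg (M i) x i) c + 2) I s2 I0.
- split; first by rewrite /= j1 j2; lia.
  have S' : esim N id k.+2 (set_reg s' x i) (set_reg (M i) x i).
    split=> [y yN|] /=; last exact: j3.2.
    by have [lt E] := j3.1 y yN; split=> //; case: eqP.
  have [|s4 E4 [S4 f4]] := IH k.+2 _ _ wc _ S'; first by lia.
  have f4' y : N <= y -> y < k.+2 -> regs s4 y = regs s' y.
    by move=> Ny yk; rewrite f4 //= gtn_eqF //; lia.
  exists (set_reg s4 k.+1 i.+1).
    have -> : ccost (set_reg (M i) x i) c + 2 =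
      1 + (ccost (set_reg (M i) x i) c + 1) by lia.
    apply: exec_seq (exec_assign _ _ _) _; rewrite /= j2.
    apply: exec_seq E4 _.
    have := exec_assign s4 k.+1 (Add (Reg k.+1) (Cst 1)).
    by rewrite /= f4' ?j2 ?addn1 //; lia.
  rewrite /I /= ?eqxx; split=> //.
  + by decide_eqn; rewrite f4' ?j1; lia.
  + split=> [y yN|] /=; last exact: S4.2.
    have [lt <-] := S4.1 y yN; split=> //.
    by rewrite ltn_eqF //; lia.
  + by move=> y Ny yk; rewrite ltn_eqF ?f4' ?j4; lia.
- by move=> s' [j1 j2 _ _]; rewrite /= j1 j2 subnn.
exists s3; last first.
  split=> //; split; last exact: j3.2.
  by move=> y yN; have [lt E] := j3.1 y yN; split=> //; lia.
have <- : 1 + (\sum_(i < heval m b) (ccost (set_reg (M i) x i) c + 2).+1).+1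
  = 2 + \sum_(i < heval m b) (ccost (set_reg (M i) x i) c + 3).
  by rewrite !addSn !add0n; do 2!congr _.+1; apply: eq_bigr => i _; lia.
exact: (exec_seq E1 (exec_seq (exec_assign s1 k.+1 (Cst 0)) E3)).
Qed.

(* [rd] is a set of variables that are never assigned and bound all loops; so
   the cost is polynomial in any bound on their values. *)
Fixpoint vok (rd : pred nat) (e : hexpr) : bool :=
  match e with
  | HC _ => true
  | HV x => rd x
  | HGet _ _ => false
  | HAdd e1 e2 => vok rd e1 && vok rd e2
  | HSub e1 e2 => vok rd e1 && vok rd e2
  | HSum x b e1 => [&& ~~ rd x, vok rd b & vok rd e1]
  end.

Fixpoint eok (rd : pred nat) (e : hexpr) : bool :=
  match e with
  | HC _ => true
  | HV _ => true
  | HGet _ e1 => eok rd e1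
  | HAdd e1 e2 => eok rd e1 && eok rd e2
  | HSub e1 e2 => eok rd e1 && eok rd e2
  | HSum x b e1 => [&& ~~ rd x, vok rd b, eok rd b & eok rd e1]
  end.

Fixpoint cok (rd : pred nat) (c : hcmd) : bool :=
  match c with
  | HAssign x e => ~~ rd x && eok rd e
  | HStore _ e1 e2 => eok rd e1 && eok rd e2
  | HSeq c1 c2 => cok rd c1 && cok rd c2
  | HIf e c1 c2 => [&& eok rd e, cok rd c1 & cok rd c2]
  | HFor x b c1 => [&& ~~ rd x, vok rd b, eok rd b & cok rd c1]
  end.

(** * Polynomial bounds on the cost *)

Definition below (rd : pred nat) (m : state) (X : nat) : Prop :=
  forall x, rd x -> regs m x <= X.

Definition polybound (rd : pred nat) (F : state -> nat) : Prop :=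
  exists C a, forall m X, 0 < X -> below rd m X -> F m <= C * X ^ a.

Lemma below_set (rd : pred nat) m X x k :
  ~~ rd x -> below rd m X -> below rd (set_reg m x k) X.
Proof. by move=> nx mX y ry /=; case: eqP ry nx => [-> -> //|_ ry _]; apply: mX. Qed.

Lemma polybound_le (rd : pred nat) (F G : state -> nat) :
  (forall m, F m <= G m) -> polybound rd G -> polybound rd F.
Proof.
move=> FG [C [a H]]; exists C, a => m X X0 mX.
exact: leq_trans (FG m) (H _ _ X0 mX).
Qed.

Lemma polybound_const rd k : polybound rd (fun=> k).
Proof. by exists k, 0 => m X _ _; rewrite muln1. Qed.

Lemma polybound_add rd F G :
  polybound rd F -> polybound rd G -> polybound rd (fun m => F m + G m).
Proof.
move=> [C [a HF]] [C' [a' HG]]; exists (C + C'), (a + a') => m X X0 mX.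
rewrite mulnDl leq_add //.
  by apply: leq_trans (HF _ _ X0 mX) _; rewrite leq_mul2l leq_pexp2l ?leq_addr ?orbT.
by apply: leq_trans (HG _ _ X0 mX) _; rewrite leq_mul2l leq_pexp2l ?leq_addl ?orbT.
Qed.

(** The summand is [H] at a state that may vary with the index but obeys the same bound [X]; so the
    two polynomials multiply. *)
Lemma polybound_sum rd F (G : state -> nat -> nat) (H : state -> nat) :
  polybound rd F -> polybound rd H ->
  (forall m X i, below rd m X -> exists2 m', below rd m' X & G m i = H m') ->
  polybound rd (fun m => \sum_(i < F m) G m i).
Proof.
move=> [C [a HF]] [C' [a' HH]] HG.
exists (C * C'), (a + a') => m X X0 mX.
apply: (@leq_trans (\sum_(i < F m) C' * X ^ a')).
  apply: leq_sum => i _; have [m' m'X ->] := HG m X i mX.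
  exact: HH.
rewrite sum_nat_const card_ord expnD mulnACA leq_mul2r.
by rewrite HF ?orbT.
Qed.

Lemma vok_bound rd e : vok rd e -> polybound rd (fun m => heval m e).
Proof.
elim: e => [k|x|//|e1 IH1 e2 IH2|e1 IH1 e2 IH2|x b IHb e IH] /=.
- by move=> _; apply: polybound_const.
- by move=> rx; exists 1, 1 => m X _ mX; rewrite mul1n; apply: mX.
- by move=> /andP[/IH1 h1 /IH2 h2]; apply: polybound_add.
- move=> /andP[/IH1 h1 _]; apply: polybound_le h1 => m; exact: leq_subr.
- move=> /and3P[nx /IHb hb /IH he]; 
  apply: (polybound_sum (G := fun m i => heval (set_reg m x i) e) hb he).
  move=> m X i mX.
  by exists (set_reg m x i) => //; apply: below_set.
Qed.

Lemma eok_bound rd e : eok rd e -> polybound rd (fun m => ecost m e).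
Proof.
have c1 := polybound_const rd 1; have c3 := polybound_const rd 3.
elim: e => [k|x|a e IH|e1 IH1 e2 IH2|e1 IH1 e2 IH2|x b IHb e IH] //=.
- by move=> /IH h; apply: polybound_add.
- by move=> /andP[/IH1 h1 /IH2 h2]; do 2!apply: polybound_add => //.
- by move=> /andP[/IH1 h1 /IH2 h2]; do 2!apply: polybound_add => //.
- move=> /and4P[nx /vok_bound vb /IHb hb /IH he].
  do 2!apply: polybound_add => //.
  apply: (polybound_sum (G := fun m i => ecost (set_reg m x i) e + 3)
    vb (polybound_add he c3)) => m X i mX.
  by exists (set_reg m x i) => //; apply: below_set.
Qed.

Lemma cok_regs rd c m x : cok rd c -> rd x -> regs (hrun c m) x = regs m x.
Proof.
elim: c m => [y e|a e1 e2|c1 IH1 c2 IH2|e c1 IH1 c2 IH2|y b c IH] m //=.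
- by move=> /andP[ny _] rx; case: eqP rx ny => // -> ->.
- by move=> /andP[k1 k2] rx; rewrite IH2 ?IH1.
- by move=> /and3P[_ k1 k2] rx; case: ifP => _; rewrite ?IH1 ?IH2.
- move=> /and4P[ny _ _ kc] rx; elim: (heval m b) => //= i IHi.
  by rewrite IH //= IHi; case: eqP rx ny => // -> ->.
Qed.

(** The variables in [rd] keep their values, so the bound [X] on them survives in every intermediate
    state. *)
Lemma cok_bound rd c : cok rd c -> polybound rd (fun m => ccost m c).
Proof.
have below_run c' m X : cok rd c' -> below rd m X -> below rd (hrun c' m) X.
  by move=> k' mX x rx; rewrite (cok_regs _ k') // mX.
have k1 := polybound_const rd 1; have k3 := polybound_const rd 3.
elim: c => [x e|a e1 e2|c1 IH1 c2 IH2|e c1 IH1 c2 IH2|x b c IH] /=.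
- by move=> /andP[_ /eok_bound h]; apply: polybound_add.
- by move=> /andP[/eok_bound h1 /eok_bound h2]; do 2!apply: polybound_add => //.
- move=> /andP[o1 o2]; have [C [a h1]] := IH1 o1; have [C' [a' h2]] := IH2 o2.
  exists (C + C'), (a + a') => m X X0 mX.
  have h2' := h2 _ _ X0 (below_run _ _ _ o1 mX).
  rewrite mulnDl leq_add //.
    by apply: leq_trans (h1 _ _ X0 mX) _; rewrite leq_mul2l leq_pexp2l ?leq_addr ?orbT.
  by apply: leq_trans h2' _; rewrite leq_mul2l leq_pexp2l ?leq_addl ?orbT.
- move=> /and3P[/eok_bound h /IH1 h1 /IH2 h2].
  have := polybound_add (polybound_add h k1) (polybound_add h1 h2).
  by apply: polybound_le => m; case: ifP => _; lia.
- move=> /and4P[nx /vok_bound vb /eok_bound eb oc].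
  apply: polybound_add eb (polybound_add (polybound_const rd 2) _).
  apply: (polybound_sum (G := fun m i => ccost (set_reg (iteri i
      (fun i m' => hrun c (set_reg m' x i)) m) x i) c + 3)
    vb (polybound_add (IH oc) k3)) => m X i mX.
  eexists; last by [].
  apply: below_set => //; elim: i => //= i IHi.
  by apply: below_run => //; apply: below_set.
Qed.

(** * Registers and arrays left unchanged by a program *)

Fixpoint assigns (x : nat) (c : hcmd) : bool :=
  match c with
  | HAssign y _ => x == y
  | HStore _ _ _ => false
  | HSeq c1 c2 => assigns x c1 || assigns x c2
  | HIf _ c1 c2 => assigns x c1 || assigns x c2
  | HFor y _ c1 => (x == y) || assigns x c1
  end.

Fixpoint stores (a : nat) (c : hcmd) : bool :=
  match c with
  | HAssign _ _ => false
  | HStore b _ _ => a == b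
  | HSeq c1 c2 => stores a c1 || stores a c2
  | HIf _ c1 c2 => stores a c1 || stores a c2
  | HFor _ _ c1 => stores a c1
  end.

Lemma hrun_reg x c m : ~~ assigns x c -> regs (hrun c m) x = regs m x.
Proof.
elim: c m => [y e|a e1 e2|c1 IH1 c2 IH2|e c1 IH1 c2 IH2|y b c IH] m //=.
- by move=> /negPf->.
- by rewrite negb_or => /andP[n1 n2]; rewrite IH2 ?IH1.
- by rewrite negb_or => /andP[n1 n2]; case: ifP => _; rewrite ?IH1 ?IH2.
- rewrite negb_or => /andP[/negPf ny nc].
  by elim: (heval m b) => //= i IHi; rewrite IH //= ny.
Qed.

Lemma hrun_arr a c m i : ~~ stores a c -> arrs (hrun c m) a i = arrs m a i.
Proof.
elim: c m => [y e|b e1 e2|c1 IH1 c2 IH2|e c1 IH1 c2 IH2|y b c IH] m //=.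
- by move=> /negPf->.
- by rewrite negb_or => /andP[n1 n2]; rewrite IH2 ?IH1.
- by rewrite negb_or => /andP[n1 n2]; case: ifP => _; rewrite ?IH1 ?IH2.
- by move=> nc; elim: (heval m b) => //= j IHj; rewrite IH.
Qed.

Lemma iteri_ind (T : Type) (P : nat -> T -> Prop) (f : nat -> T -> T) n x :
  P 0 x -> (forall i y, i < n -> P i y -> P i.+1 (f i y)) -> P n (iteri n f x).
Proof.
move=> P0 PS; have: n <= n by []; elim: {1 3 4}n => //= i IH lt_in.
by apply: PS => //; apply: IH; apply: ltnW.
Qed.

(** * The algorithm *)

(* Variables: 0, 1, 2 hold [n], [d], [K]; 3 the number of guesses; 10 the
   current guess; 11 the success flag; 12 the colours still to be used, as
   digits in base [K.+1]; 15 the last vertex of the prefix; 17 the failure flag;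
   variables from 30 on are bound by sums.  Arrays: 2 holds the colours, 3 the
   set being peeled down to the core, 4 the batch. *)
Definition e_not e := HSub (HC 1) e.
Definition e_and e1 e2 := HSub (HC 1) (HAdd (e_not e1) (e_not e2)).
Definition e_or e1 e2 := e_not (e_not (HAdd e1 e2)).
Definition e_le e1 e2 := e_not (HSub e1 e2).
Definition e_lt e1 e2 := e_le (HAdd e1 (HC 1)) e2.
Definition e_eq e1 e2 := e_not (HAdd (HSub e1 e2) (HSub e2 e1)).
Definition e_neq e1 e2 := e_not (e_eq e1 e2).
(* A product; [e2] must not read variable 59. *)
Definition e_mul e1 e2 := HSum 59 e1 e2.

Lemma heval_not m e : heval m (e_not e) = (heval m e == 0).
Proof. by move=> /=; case: (heval m e). Qed.

Lemma heval_and m e1 e2 :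
  heval m (e_and e1 e2) = (heval m e1 != 0) && (heval m e2 != 0).
Proof. by move=> /=; case: (heval m e1) => [|x]; case: (heval m e2). Qed.

Lemma heval_or m e1 e2 :
  heval m (e_or e1 e2) = (heval m e1 != 0) || (heval m e2 != 0).
Proof.
by rewrite /e_or !heval_not /=; case: (heval m e1) => [|x]; case: (heval m e2).
Qed.

Lemma heval_le m e1 e2 : heval m (e_le e1 e2) = (heval m e1 <= heval m e2).
Proof. by rewrite /e_le heval_not. Qed.

Lemma heval_lt m e1 e2 : heval m (e_lt e1 e2) = (heval m e1 < heval m e2).
Proof. by rewrite /e_lt heval_le /= addn1. Qed.

Lemma heval_eq m e1 e2 : heval m (e_eq e1 e2) = (heval m e1 == heval m e2).
Proof. by rewrite /e_eq heval_not /= addn_eq0 !subn_eq0 -eqn_leq. Qed.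

Lemma heval_neq m e1 e2 : heval m (e_neq e1 e2) = (heval m e1 != heval m e2).
Proof. by rewrite /e_neq heval_not heval_eq eqb0. Qed.

Lemma boolN0 (b : bool) : ((b : nat) != 0) = b. Proof. by case: b. Qed.

Lemma heval_mul m e1 e2 : (forall i, heval (set_reg m 59 i) e2 = heval m e2) ->
  heval m (e_mul e1 e2) = heval m e1 * heval m e2.
Proof.
by move=> h /=; under eq_bigr => i _ do rewrite h; rewrite sum_nat_const card_ord.
Qed.

Definition e_seed := HAdd (e_mul (HC 4) (HV 1)) (HC 4).
Definition e_junk :=
  HAdd (e_mul (e_mul (HC 4) (HV 1)) (HV 2)) (e_mul (HV 2) e_seed).
Definition e_core := e_mul (HC 2) (HAdd (HAdd (HV 1) e_junk) (HC 1)).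
Definition e_agree := e_mul (e_mul (HV 2) (HV 2))
  (HAdd (e_mul (HC 2) (HAdd (HV 1) e_core)) (HC 1)).
Definition e_hub := HAdd e_agree (HC 1).
Definition e_batch := HAdd (HAdd e_junk (HC 1))
  (e_mul e_hub (HAdd (e_mul (HC 2) e_core) (HC 2))).

Lemma heval_add m e1 e2 : heval m (HAdd e1 e2) = heval m e1 + heval m e2.
Proof. by []. Qed.

Lemma heval_seed m : heval m e_seed = seed_size (regs m 1).
Proof. by rewrite /e_seed heval_add heval_mul. Qed.

Lemma heval_junk m : heval m e_junk = junk_bound (regs m 1) (regs m 2).
Proof.
by rewrite /e_junk heval_add !heval_mul // heval_seed.
Qed.

Lemma heval_core m : heval m e_core = core_deg (regs m 1) (regs m 2).
Proof.
by rewrite /e_core heval_mul // 2!heval_add heval_junk.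
Qed.

Lemma heval_agree m : heval m e_agree = agree_bound (regs m 1) (regs m 2).
Proof.
have h m' : heval m' (HAdd (e_mul (HC 2) (HAdd (HV 1) e_core)) (HC 1)) =
    2 * (regs m' 1 + core_deg (regs m' 1) (regs m' 2)) + 1.
  by rewrite heval_add heval_mul // heval_add heval_core.
by rewrite /e_agree heval_mul // h heval_mul.
Qed.

Lemma heval_hub m : heval m e_hub = hub_ratio (regs m 1) (regs m 2).
Proof. by rewrite /hub_ratio -heval_agree. Qed.

Lemma heval_batch m : heval m e_batch = batch_size (regs m 1) (regs m 2).
Proof.
have h m' : heval m' (HAdd (e_mul (HC 2) e_core) (HC 2)) =
    2 * core_deg (regs m' 1) (regs m' 2) + 2.
  by rewrite heval_add heval_mul // heval_core.
by rewrite /e_batch 2!heval_add heval_junk heval_mul // h heval_hub.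
Qed.

Definition e_adj x y := HGet 0 (HAdd (e_mul (HV 0) (HV x)) (HV y)).
Definition e_cls w c := e_eq (HGet 2 (HV w)) (HAdd (HV c) (HC 1)).
Definition e_card c := HSum 30 (HV 0) (e_cls 30 c).
Definition e_rep c := e_le e_seed (e_card c).
Definition e_degcls v c := HSum 31 (HV 0) (e_and (e_cls 31 c) (e_adj v 31)).
Definition e_maj v c := e_lt (e_card c) (HAdd (e_degcls v c) (e_degcls v c)).
Definition e_pairs c c' := HSum 32 (HV 0) (HSum 33 (HV 0)
  (e_and (e_and (e_cls 32 c) (e_cls 33 c')) (e_adj 32 33))).
Definition e_prod c c' := HSum 32 (HV 0) (HSum 33 (HV 0)
  (e_and (e_cls 32 c) (e_cls 33 c'))).
Definition e_dense c c' := e_lt (e_prod c c') (HAdd (e_pairs c c') (e_pairs c c')).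
Definition e_fits v c := e_and (e_rep c) (e_not (HSum 34 (HV 2)
  (e_and (e_rep 34) (e_neq (e_maj v 34) (e_dense c 34))))).
Definition e_typ v := HSum 35 (HV 2) (e_fits v 35).
Definition e_pat v w := HSum 36 (HV 2) (HSum 37 (HV 2)
  (e_and (e_fits v 36) (e_and (e_fits w 37) (e_dense 36 37)))).
Definition e_guess v w := e_and (e_neq (HV v) (HV w))
  (e_neq (e_adj v w) (e_not (e_not (e_pat v w)))).

Lemma sum_exists k (P : pred 'I_k) : (\sum_(i < k) (P i : nat) != 0) = [exists i, P i].
Proof.
rewrite sum_nat_eq0 negb_forall; apply: eq_existsb => i.
by case: (P i).
Qed.

Lemma index_inj n (i j i' j' : 'I_n) : i * n + j = i' * n + j' -> i = i' /\ j = j'.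
Proof.
have n_gt0 : 0 < n by apply: leq_ltn_trans (ltn_ord i).
move=> e; have ei : i = i'.
  apply: val_inj; have := congr1 (divn^~ n) e.
  by rewrite !divnMDl // !divn_small // !addn0.
by move: e; rewrite ei => /addnI/val_inj ->.
Qed.

Lemma adj_arrayE n (G : sgraph n) (i j : 'I_n) : adj_array G (i * n + j) = G i j.
Proof.
rewrite /adj_array; congr nat_of_bool; apply/existsP/idP => [[i']|Gij]; last first.
  by exists i; apply/existsP; exists j; rewrite eqxx.
by case/existsP=> j' /andP[/eqP/index_inj[-> ->]].
Qed.

Lemma regs_set_neq m x y k : y != x -> regs (set_reg m x k) y = regs m y.
Proof. by move=> /negPf /= ->. Qed.

Lemma regs_set_eq m x k : regs (set_reg m x k) x = k.
Proof. by rewrite /= eqxx. Qed.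

(** Variables that can be passed to the formulas without capture: their inner sums bind 30 to 37 and
    59. The range from 40 serves the sums built around these formulas. *)
Definition vname (x : nat) : bool := (2 < x < 30) || (40 <= x < 50).

(** * Evaluation of the formulas *)

Section Formulas.
Variables (n d K : nat) (G' : sgraph n) (kap : 'I_n -> nat).

Definition ctx (m : state) : Prop :=
  [/\ regs m 0 = n, regs m 1 = d, regs m 2 = K,
      forall k, arrs m 0 k = adj_array G' k &
      forall v : 'I_n, arrs m 2 v = kap v].

Lemma ctx_set m x k : 2 < x -> ctx m -> ctx (set_reg m x k).
Proof.
by move=> lt [c0 c1 c2 a0 a2]; split=> //; rewrite regs_set_neq //; lia.
Qed.

Lemma sum_vertices m x e (F : 'I_n -> nat) : ctx m ->
  (forall v : 'I_n, heval (set_reg m x v) e = F v) ->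
  heval m (HSum x (HV 0) e) = \sum_v F v.
Proof. by move=> [c0 _ _ _ _] h /=; rewrite c0; apply: eq_bigr. Qed.

Lemma sum_colours m x e (F : 'I_K -> nat) : ctx m ->
  (forall c : 'I_K, heval (set_reg m x c) e = F c) ->
  heval m (HSum x (HV 2) e) = \sum_c F c.
Proof. by move=> [_ _ c2 _ _] h /=; rewrite c2; apply: eq_bigr. Qed.

Lemma heval_adj m x y (v w : 'I_n) : ctx m -> x != 59 -> y != 59 ->
  regs m x = v -> regs m y = w -> heval m (e_adj x y) = G' v w.
Proof.
move=> [c0 _ _ a0 _] x59 y59 mx my.
rewrite /e_adj /= a0 c0 (eq_bigr (fun=> nat_of_ord v)) => [|i _].
  by rewrite sum_nat_const card_ord mulnC my adj_arrayE.
by rewrite (negPf x59).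
Qed.

Lemma heval_cls m x y (v : 'I_n) c : ctx m ->
  regs m x = v -> regs m y = c -> heval m (e_cls x y) = (v \in cls kap c).
Proof.
by move=> [_ _ _ _ a2] mx my; rewrite /e_cls heval_eq /= mx my a2 addn1 inE.
Qed.

Lemma heval_card m y c : ctx m -> y != 30 -> regs m y = c ->
  heval m (e_card y) = #|cls kap c|.
Proof.
move=> cm y30 my; rewrite /e_card (sum_vertices (F := fun v => v \in cls kap c)) //.
  by rewrite -sum1_card [RHS]big_mkcond; apply: eq_bigr => v _; case: ifP.
by move=> v; apply: heval_cls; rewrite ?regs_set_eq ?regs_set_neq.
Qed.

Lemma heval_rep m y c : ctx m -> y != 30 -> regs m y = c ->
  heval m (e_rep y) = represented (seed_size d) kap c.
Proof.
move=> cm y30 my; rewrite /e_rep heval_le (heval_card cm y30 my) heval_seed.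
by case: cm => _ -> _ _ _.
Qed.

Lemma sum_in (Z : {set 'I_n}) (F : 'I_n -> nat) :
  \sum_(v in Z) F v = \sum_v (v \in Z) * F v.
Proof. by rewrite big_mkcond; apply: eq_bigr => v _; case: ifP; rewrite ?mul1n. Qed.

Lemma heval_maj m x y (v : 'I_n) c : ctx m -> vname x -> 34 <= y < 38 ->
  regs m x = v -> regs m y = c -> heval m (e_maj x y) = majority G' kap v c.
Proof.
rewrite /vname => cm nx ny mx my; rewrite /e_maj heval_lt.
rewrite (heval_card cm _ my) ?heval_add; last by lia.
rewrite (_ : heval m (e_degcls x y) = deg G' (cls kap c) v) ?addnn -?mul2n //.
rewrite /deg sum_in; apply: sum_vertices => // w.
have cm' : ctx (set_reg m 31 w) by apply: ctx_set.
rewrite heval_and (heval_cls (v := w) (c := c) cm') ?regs_set_eq ?regs_set_neq //; try lia.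
rewrite (heval_adj (v := v) (w := w) cm') ?regs_set_eq ?regs_set_neq //; try lia.
by rewrite !boolN0 mulnb.
Qed.

Lemma heval_dense m x y c c' : ctx m -> 34 <= x < 38 -> 34 <= y < 38 ->
  regs m x = c -> regs m y = c' -> heval m (e_dense x y) = dense G' kap c c'.
Proof.
move=> cm nx ny mx my.
have H v w : let m' := set_reg (set_reg m 32 (v : 'I_n)) 33 (w : 'I_n) in
    [/\ heval m' (e_cls 32 x) = (v \in cls kap c),
        heval m' (e_cls 33 y) = (w \in cls kap c') &
        heval m' (e_adj 32 33) = G' v w].
  move=> m'; have cm' : ctx m' by do 2!apply: ctx_set => //.
  split; first by apply: heval_cls; rewrite // ?regs_set_neq //; lia.
    by apply: heval_cls; rewrite ?regs_set_eq // !regs_set_neq //; lia.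
  by apply: heval_adj.
rewrite /e_dense heval_lt heval_add.
have -> : heval m (e_prod x y) = #|cls kap c| * #|cls kap c'|.
  rewrite -sum_nat_const sum_in; apply: sum_vertices => // v.
  rewrite -sum1_card sum_in big_distrr.
  apply: sum_vertices => [|w]; first exact: ctx_set.
  by have [h1 h2 _] := H v w; rewrite heval_and h1 h2 !boolN0 /= muln1 mulnb.
have -> : heval m (e_pairs x y) = pairs G' (cls kap c) (cls kap c').
  rewrite /pairs sum_in; apply: sum_vertices => // v.
  rewrite sum_in big_distrr.
  apply: sum_vertices => [|w]; first exact: ctx_set.
  have [h1 h2 h3] := H v w.
  by rewrite !heval_and h1 h2 h3 !boolN0 /= mulnA !mulnb.
by rewrite addnn -mul2n.
Qed.

Lemma heval_fits m x y (v : 'I_n) (c : nat) : ctx m -> vname x -> 34 < y < 38 ->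
  regs m x = v -> regs m y = c ->
  heval m (e_fits x y) = fits K (seed_size d) G' kap v c.
Proof.
move=> cm nx ny mx my; rewrite /e_fits heval_and heval_not !boolN0.
rewrite (heval_rep cm _ my) ?boolN0; last by lia.
congr (nat_of_bool (_ && _)).
rewrite (sum_colours (F := fun c' => (represented (seed_size d) kap c' &&
    (majority G' kap v c' != dense G' kap c c')))) // => [|c'].
  apply: negb_inj; rewrite sum_exists negb_forall; apply: eq_existsb => c'.
  by rewrite negb_imply.
have cm' : ctx (set_reg m 34 c') by apply: ctx_set.
have nx' : x != 34 by move: nx; rewrite /vname; lia.
rewrite heval_and (heval_rep cm' (c := c')) ?regs_set_eq // heval_neq.
rewrite (heval_maj cm' (v := v) (c := c')) ?regs_set_eq ?regs_set_neq //.
rewrite (heval_dense cm' (c := c) (c' := c')) ?regs_set_eq ?regs_set_neq //; lia.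
Qed.

Notation typ := (typical K (seed_size d) G' kap).
Notation gue := (guess K (seed_size d) G' kap).

Lemma heval_typ m x (v : 'I_n) : ctx m -> vname x -> regs m x = v ->
  (heval m (e_typ x) != 0) = typ v.
Proof.
move=> cm nx mx.
rewrite /e_typ (sum_colours (F := fun c => fits K (seed_size d) G' kap v c)) //.
  exact: sum_exists.
by move=> c; apply: heval_fits; rewrite ?regs_set_eq ?regs_set_neq //;
  move: nx; rewrite /vname; lia.
Qed.

Lemma heval_guess m x y (v w : 'I_n) : ctx m -> vname x -> vname y ->
  regs m x = v -> regs m y = w -> heval m (e_guess x y) = gue v w.
Proof.
move=> cm nx ny mx my; rewrite /e_guess heval_and !heval_neq !boolN0.
have [x59 y59] : x != 59 /\ y != 59 by move: nx ny; rewrite /vname; lia.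
rewrite (heval_adj cm x59 y59 mx my) !heval_not -/(is_true _).
congr (nat_of_bool (_ && _)); first by rewrite /= mx my.
rewrite eqb0 (_ : (heval m (e_pat x y) != 0) = pat K (seed_size d) G' kap v w).
  by case: (G' v w); case: (pat _ _ _ _ _ _).
rewrite /e_pat (sum_colours (F := fun c => \sum_(c' : 'I_K)
  [&& fits K (seed_size d) G' kap v c, fits K (seed_size d) G' kap w c' &
      dense G' kap c c'])) // => [|c].
  transitivity (\sum_(c < K) [exists c' : 'I_K,
      [&& fits K (seed_size d) G' kap v c, fits K (seed_size d) G' kap w c' &
      dense G' kap c c']] != 0); last by rewrite sum_exists.
  rewrite !sum_nat_eq0; congr (~~ _); apply: eq_forallb => c.
  by rewrite -sum_exists; case: (\sum_(_ < _) _).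
apply: sum_colours => [|c']; first exact: ctx_set.
have cm' : ctx (set_reg (set_reg m 36 c) 37 c') by do 2!apply: ctx_set => //.
have n36 z : vname z -> (z != 36) /\ (z != 37) by rewrite /vname; lia.
have [[x1 x2] [y1 y2]] := (n36 x nx, n36 y ny).
rewrite 2!heval_and.
have mx' : regs (set_reg (set_reg m 36 c) 37 c') x = v by rewrite !regs_set_neq.
have my' : regs (set_reg (set_reg m 36 c) 37 c') y = w by rewrite !regs_set_neq.
rewrite (heval_fits (y := 36) (c := c) cm' nx _ mx') //.
rewrite (heval_fits (y := 37) (c := c') cm' ny _ my') //.
rewrite (heval_dense (x := 36) (y := 37) (c := c) (c' := c') cm') //.
by rewrite !boolN0.
Qed.
End Formulas.

Lemma hrun_for x b c m : hrun (HFor x b c) m =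
  iteri (heval m b) (fun i m' => hrun c (set_reg m' x i)) m.
Proof. by []. Qed.

Lemma hrun_seq c1 c2 m : hrun (HSeq c1 c2) m = hrun c2 (hrun c1 m).
Proof. by []. Qed.

Lemma hrun_if e c1 c2 m : hrun (HIf e c1 c2) m =
  if heval m e != 0 then hrun c1 m else hrun c2 m.
Proof. by []. Qed.

Lemma hrun_assign x e m : hrun (HAssign x e) m = set_reg m x (heval m e).
Proof. by []. Qed.

Lemma heval_sum m x b e : heval m (HSum x b e) =
  \sum_(i < heval m b) heval (set_reg m x i) e.
Proof. by []. Qed.

Lemma heval_sub m e1 e2 : heval m (HSub e1 e2) = heval m e1 - heval m e2.
Proof. by []. Qed.

Lemma heval_var m x : heval m (HV x) = regs m x.
Proof. by []. Qed.

(** The formula is evaluated while array [a] is partly overwritten, so its value must be determined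
    by the other arrays. *)
Lemma hrun_fill n m x a e (F : 'I_n -> nat) : regs m 0 = n ->
  (forall m' (v : 'I_n),
     (forall y, y != x -> regs m' y = regs m y) ->
     (forall b j, b != a -> arrs m' b j = arrs m b j) ->
     heval (set_reg m' x v) e = F v) ->
  forall v : 'I_n, arrs (hrun (HFor x (HV 0) (HStore a (HV x) e)) m) a v = F v.
Proof.
move=> m0 h v.
pose I i m' := [/\ forall y, y != x -> regs m' y = regs m y,
  forall b j, b != a -> arrs m' b j = arrs m b j &
  forall u : 'I_n, u < i -> arrs m' a u = F u].
suff [_ _ ->] : I n (hrun (HFor x (HV 0) (HStore a (HV x) e)) m) by [].
rewrite hrun_for heval_var m0; apply: iteri_ind => [|i m' lt_i [i1 i2 i3]] //.
split=> [y yx|b k ba|u] /=.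
- by rewrite (negPf yx) i1.
- by rewrite (negPf ba) i2.
rewrite ltnS !eqxx leq_eqVlt; case: eqP => [<- _|_] /=; first by rewrite h.
exact: i3.
Qed.

(** * The program *)

Definition h_skip := HAssign 19 (HC 0).

Definition e_deg x := HSum 40 (HV 0) (e_and (HGet 3 (HV 40)) (e_guess x 40)).
Definition e_alive := HSum 41 (HV 0) (e_not (e_not (HGet 3 (HV 41)))).
Definition e_injunk x := e_and (e_le (HV x) (HV 15)) (e_not (e_typ x)).
Definition e_junkcard := HSum 42 (HV 0) (e_injunk 42).

Definition p_init := HFor 13 (HV 0)
  (HStore 3 (HV 13) (e_and (e_le (HV 13) (HV 15)) (e_typ 13))).
Definition p_pass := HFor 13 (HV 0)
  (HStore 3 (HV 13) (e_and (HGet 3 (HV 13)) (e_lt e_core (e_deg 13)))).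
Definition p_peel := HFor 16 (HV 0) p_pass.
Definition p_mark := HFor 13 (HV 0) (HStore 4 (HV 13)
  (e_or (e_injunk 13)
     (e_and (HGet 3 (HV 13)) (e_le e_alive (e_mul e_hub (e_deg 13)))))).
Definition p_test := HSeq p_init (HSeq p_peel
  (HSeq (HAssign 17 (e_or e_alive (e_lt e_junk e_junkcard))) p_mark)).
Definition p_scan := HSeq (HAssign 17 (HC 0))
  (HFor 15 (HV 0) (HIf (HV 17) h_skip p_test)).
Definition p_accept := HSeq (HAssign 11 (HC 1))
  (HFor 13 (HV 0) (HFor 18 (HV 0)
    (HStore 1 (HAdd (e_mul (HV 0) (HV 13)) (HV 18)) (e_guess 13 18)))).
(** Division by [K.+1], done by counting the positive multiples of [K.+1] up to the dividend;
    register 3 bounds the dividend, hence also the count. *)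
Definition e_quot := HSum 50 (HV 3)
  (e_le (e_mul (HAdd (HV 2) (HC 1)) (HAdd (HV 50) (HC 1))) (HV 12)).
Definition e_digit := HSub (HV 12) (e_mul (HAdd (HV 2) (HC 1)) e_quot).
Definition p_colour := HFor 13 (HV 0) (HIf (HGet 4 (HV 13))
  (HSeq (HStore 2 (HV 13) e_digit) (HAssign 12 e_quot)) h_skip).
Definition p_round := HSeq p_scan (HIf (HV 17) p_colour p_accept).
(** [K] rounds may each colour a batch; one more is needed to accept. *)
Definition p_rounds := HFor 14 (HAdd (HV 2) (HC 1)) (HIf (HV 11) h_skip p_round).
Definition p_guess := HSeq (HAssign 12 (HV 10))
  (HSeq (HFor 13 (HV 0) (HStore 2 (HV 13) (HC 0))) p_rounds).
Definition p_main := HFor 10 (HV 3) (HIf (HV 11) h_skip p_guess).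
Definition p_setup := HSeq (HAssign 3 (HC 1)) (HFor 16 (e_mul (HV 2) e_batch)
  (HAssign 3 (e_mul (HAdd (HV 2) (HC 1)) (HV 3)))).

Lemma sum_lt P q : \sum_(j < P) (j < q : nat) = minn P q.
Proof. by elim: P => [|P IH]; rewrite ?big_ord0 ?big_ord_recr /= ?IH; lia. Qed.

Lemma count_div P b x : 0 < b -> x <= P -> \sum_(j < P) (b * j.+1 <= x) = x %/ b.
Proof.
move=> b0 xP; rewrite (eq_bigr (fun j : 'I_P => (j < x %/ b : nat))) => [|j _].
  by rewrite sum_lt; apply/minn_idPr; apply: leq_trans (leq_div _ _) xP.
by rewrite leq_divRL // mulnC.
Qed.

Lemma arrs_store m a e1 e2 j : arrs (hrun (HStore a e1 e2) m) a j =
  if j == heval m e1 then heval m e2 else arrs m a j.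
Proof. by rewrite /= eqxx. Qed.

(** * Correctness of the program *)

Section Execution.
Variables (n d K : nat) (G' : sgraph n).

Notation dp := (core_deg d K).
Notation ctx := (ctx d K G').
Notation typ kap := (typical K (seed_size d) G' kap).
Notation gue kap := (guess K (seed_size d) G' kap).

Definition alive (m : state) : {set 'I_n} := [set v : 'I_n | arrs m 3 v != 0].

Lemma ctx_run c m kap : [&& ~~ assigns 0 c, ~~ assigns 1 c, ~~ assigns 2 c,
  ~~ stores 0 c & ~~ stores 2 c] -> ctx kap m -> ctx kap (hrun c m).
Proof.
move=> /and5P[r0 r1 r2 s0 s2] [c0 c1 c2 a0 a2]; split; rewrite ?hrun_reg //.
  by move=> k; rewrite hrun_arr.
by move=> v; rewrite hrun_arr.
Qed.

Lemma ctx_agree kap m m' : ctx kap m ->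
  (forall y, y <= 2 -> regs m' y = regs m y) ->
  (forall b j, b != 3 -> b != 4 -> arrs m' b j = arrs m b j) -> ctx kap m'.
Proof. by move=> [c0 c1 c2 a0 a2] E1 E2; split=> *; rewrite ?E1 ?E2. Qed.

Section Fixed.
Variable kap : 'I_n -> nat.

Lemma heval_deg m x (v : 'I_n) : ctx kap m -> vname x -> x != 40 -> regs m x = v ->
  heval m (e_deg x) = deg (gue kap) (alive m) v.
Proof.
move=> cm nx x40 mx; rewrite /deg sum_in; apply: (sum_vertices cm) => w.
have cm' : ctx kap (set_reg m 40 w) by apply: ctx_set.
have gE : heval (set_reg m 40 w) (e_guess x 40) = gue kap v w.
  by apply: heval_guess; rewrite // regs_set_neq.
by rewrite heval_and gE boolN0 inE mulnb.
Qed.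

Lemma heval_alive m : ctx kap m -> heval m e_alive = #|alive m|.
Proof.
move=> cm; rewrite -sum1_card sum_in; apply: (sum_vertices cm) => w.
by rewrite !heval_not inE eqb0 muln1.
Qed.

Lemma heval_injunk m x (v : 'I_n) : ctx kap m -> vname x -> regs m x = v ->
  heval m (e_injunk x) = (v \in junk_prefix K d G' kap (regs m 15)).
Proof.
move=> cm nx mx; rewrite heval_and heval_le heval_not !boolN0 inE.
by rewrite -(heval_typ cm nx mx) negbK -mx.
Qed.

Lemma heval_junkcard m : ctx kap m ->
  heval m e_junkcard = #|junk_prefix K d G' kap (regs m 15)|.
Proof.
move=> cm; rewrite -sum1_card sum_in; apply: (sum_vertices cm) => w.
by rewrite (heval_injunk (v := w) (ctx_set _ _ cm)) // muln1.
Qed.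

Lemma run_init m : ctx kap m ->
  alive (hrun p_init m) = typ_prefix K d G' kap (regs m 15).
Proof.
move=> cm; apply/setP => v; rewrite !inE.
have c0 : regs m 0 = n by case: cm.
rewrite (hrun_fill (F := fun u => (u <= regs m 15) && typ kap u) c0) ?boolN0 //.
move=> m' u E1 E2.
have cm' : ctx kap (set_reg m' 13 u).
  apply: ctx_set => //; apply: ctx_agree cm _ _ => [y y2|b j b3 _]; last exact: E2.
  by apply: E1; lia.
rewrite heval_and heval_le boolN0 (heval_typ cm' (v := u)) //.
by rewrite -(E1 15).
Qed.

(** Deletions take effect at once, so later vertices are tested against a smaller set. A stable
    subset still survives, and a pass that deletes nothing has tested every vertex against [Z]. *)
Lemma run_pass m : ctx kap m -> let Z := alive m in let m1 := hrun p_pass m in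
  [/\ alive m1 \subset Z,
      forall C : {set 'I_n}, C \subset Z -> stable dp (gue kap) C -> C \subset alive m1 &
      alive m1 = Z -> stable dp (gue kap) Z].
Proof.
move=> cm Z m1.
pose I i m' := [/\ ctx kap m', alive m' \subset Z,
  forall C : {set 'I_n}, C \subset Z -> stable dp (gue kap) C -> C \subset alive m' &
  forall u, u \in alive m' -> u < i -> dp < deg (gue kap) Z u].
have c0 : regs m 0 = n by case: cm.
suff [_ s1 s2 s3] : I n m1.
  split=> // e; apply/forall_inP => u uZ; apply: s3 => //; by rewrite e.
rewrite /m1 hrun_for heval_var c0.
apply: iteri_ind => [|i m' lt_i [cm' s1 s2 s3]]; first by split.
set v := Ordinal lt_i; have cm2 : ctx kap (set_reg m' 13 v) by apply: ctx_set.
set b := (v \in alive m') && (dp < deg (gue kap) (alive m') v).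
set m2 := hrun _ _.
have al u : (u \in alive m2) = if u == v then b else u \in alive m'.
  rewrite inE /m2 arrs_store heval_var regs_set_eq.
  case: (eqVneq u v) => [->|ne]; last first.
    by rewrite ifN ?inE //; apply: contra ne => /eqP e; apply/eqP/val_inj.
  rewrite eqxx.
  rewrite heval_and heval_lt boolN0 heval_core [heval _ (HGet _ _)]/=.
  rewrite (heval_deg (v := v)) // boolN0 /b inE.
  by have [_ c1 c2 _ _] := cm2; rewrite c1 c2.
have sub : alive m2 \subset alive m'.
  by apply/subsetP=> u; rewrite al; case: eqP => [->|//]; rewrite /b; case/andP.
split.
- by apply: ctx_run cm2.
- exact: subset_trans sub s1.
- move=> C CZ sC; apply/subsetP=> u uC; rewrite al.
  have CA := s2 C CZ sC; have uA := subsetP CA _ uC.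
  case: eqP => [e|//]; rewrite /b -e uA /=.
  by have /forall_inP/(_ u uC) lt := sC; apply: leq_trans lt (deg_sub _ _ CA).
- move=> u; rewrite al ltnS leq_eqVlt; case: eqP => [->|ne].
    by rewrite /b => /andP[_ lt] _; apply: leq_trans lt (deg_sub _ _ s1).
  by move=> uA /orP[/eqP e|]; [case: ne; apply: val_inj|apply: s3].
Qed.

Lemma run_peel m : ctx kap m -> let Z := alive m in
  alive (hrun p_peel m) = core dp (gue kap) Z.
Proof.
move=> cm Z; set m1 := hrun _ _.
(* Until the set is stable, each pass deletes at least one vertex; so [n] passes suffice. *)
pose I i m' := [/\ ctx kap m', alive m' \subset Z,
  forall C : {set 'I_n}, C \subset Z -> stable dp (gue kap) C -> C \subset alive m' &
  stable dp (gue kap) (alive m') || (#|alive m'| + i <= n)].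
have c0 : regs m 0 = n by case: cm.
suff [_ s1 s2 s3] : I n m1.
  apply/eqP; rewrite eqEsubset s2 ?core_sub ?stable_core // andbT.
  apply: sub_core => //; case/orP: s3 => //.
  rewrite addnC -[X in _ <= X]addn0 leq_add2l leqn0 cards_eq0 => /eqP ->.
  by apply/forall_inP=> u; rewrite inE.
rewrite /m1 hrun_for heval_var c0; apply: iteri_ind => [|i m' lt_i [cm' s1 s2 s3]].
  split=> //; apply/orP; right; rewrite addn0 -[X in _ <= X](card_ord n).
  exact: max_card.
have cm2 : ctx kap (set_reg m' 16 i) by apply: ctx_set.
have [] := run_pass cm2; rewrite -/p_pass; set m2 := hrun _ _.
rewrite (_ : alive (set_reg m' 16 i) = alive m') // => t1 t2 t3; split.
- by apply: ctx_run cm2.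
- exact: subset_trans t1 s1.
- by move=> C CZ sC; apply: t2 => //; apply: s2.
- have [e|ne] := eqVneq (alive m2) (alive m'); first by rewrite e t3.
  case/orP: s3 => [st|le].
    by rewrite (_ : alive m2 = alive m') ?st //; apply/eqP; rewrite eqEsubset t1 t2.
  have : alive m2 \proper alive m' by rewrite properEneq ne.
  by move/proper_card => lt; apply/orP; right; lia.
Qed.

Notation fails := (fails K d G' kap).
Notation first_fail := (first_fail K d G' kap).

Lemma run_mark m (i : 'I_n) : ctx kap m -> regs m 15 = i ->
  alive m = core_prefix K d G' kap i ->
  forall v : 'I_n, (arrs (hrun p_mark m) 4 v != 0) = (v \in batch K d G' kap i).
Proof.
move=> cm mi am v; have [c0 _ _ _ _] := cm.
rewrite (hrun_fill (F := fun u => u \in batch K d G' kap i) c0) ?boolN0 //.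
move=> m' u E1 E2.
have cm' : ctx kap (set_reg m' 13 u).
  apply: ctx_set => //; apply: ctx_agree cm _ _ => [y y2|b j _ b4]; last exact: E2.
  by apply: E1; lia.
have am' : alive (set_reg m' 13 u) = core_prefix K d G' kap i.
  by rewrite -am; apply/setP => w; rewrite !inE /= E2.
have dE : heval (set_reg m' 13 u) (e_mul e_hub (e_deg 13)) =
    hub_ratio d K * deg (gue kap) (core_prefix K d G' kap i) u.
  rewrite heval_mul => [|k].
    rewrite heval_hub (heval_deg cm' (v := u)) // am'.
    by have [_ -> -> _ _] := cm'.
  rewrite (heval_deg (ctx_set _ _ cm') (v := u)) // (heval_deg cm' (v := u)) //.
rewrite heval_or heval_and heval_le dE (heval_injunk (v := u) cm') // !boolN0.
rewrite (heval_alive cm') am' regs_set_neq // E1 // mi.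
have -> : (heval (set_reg m' 13 u) (HGet 3 (HV 13)) != 0) =
    (u \in core_prefix K d G' kap i) by rewrite -am' inE.
by rewrite in_setU [u \in hubs _ _ _ _ _]inE.
Qed.

Lemma run_test m (i : 'I_n) : ctx kap m -> regs m 15 = i ->
  let m1 := hrun p_test m in
  [/\ ctx kap m1, (regs m1 17 != 0) = fails i &
      forall v : 'I_n, (arrs m1 4 v != 0) = (v \in batch K d G' kap i)].
Proof.
move=> cm mi m1; split; first by apply: ctx_run cm.
  rewrite /m1 /p_test; set m2 := hrun p_peel (hrun p_init m).
  have cm1 : ctx kap (hrun p_init m) by apply: ctx_run cm.
  have cm2 : ctx kap m2 by apply: ctx_run cm1.
  have am2 : alive m2 = core_prefix K d G' kap i.
    by rewrite run_peel // run_init // mi.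
  have m2i : regs m2 15 = i by rewrite !hrun_reg.
  transitivity (heval m2 (e_or e_alive (e_lt e_junk e_junkcard)) != 0).
    by rewrite !hrun_seq -/m2 hrun_reg // hrun_assign regs_set_eq.
  rewrite heval_or heval_lt heval_alive // heval_junk heval_junkcard // !boolN0.
  by have [_ -> -> _ _] := cm2; rewrite am2 m2i cards_eq0.
rewrite /m1 /p_test !hrun_seq; set m2 := hrun p_peel (hrun p_init m).
have cm1 : ctx kap (hrun p_init m) by apply: ctx_run cm.
have cm2 : ctx kap m2 by apply: ctx_run cm1.
rewrite hrun_assign; set k := heval m2 _; clearbody k; apply: run_mark.
- exact: ctx_set.
- by rewrite regs_set_neq // !hrun_reg.
- by rewrite -[LHS]/(alive m2) run_peel // run_init // mi.
Qed.

Lemma run_scan m : ctx kap m -> let m1 := hrun p_scan m in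
  ctx kap m1 /\
  (regs m1 17 = 0 /\ accepted K d G' kap \/
   regs m1 17 != 0 /\ exists2 i, first_fail i &
     forall v : 'I_n, (arrs m1 4 v != 0) = (v \in batch K d G' kap i)).
Proof.
move=> cm m1.
(* Once the flag is set the remaining prefixes are skipped, so array 4 keeps the batch of the first
   failure. *)
pose I i m' := ctx kap m' /\
  (regs m' 17 = 0 /\ (forall j : 'I_n, j < i -> ~~ fails j) \/
   regs m' 17 != 0 /\ exists2 i, first_fail i &
     forall v : 'I_n, (arrs m' 4 v != 0) = (v \in batch K d G' kap i)).
suff [cm1 h] : I n m1.
  split=> //; case: h => [[f h]|h]; [left|by right].
  by split=> // i; apply: h.
have c0 : regs m 0 = n by case: cm.
rewrite /m1 /p_scan hrun_seq hrun_for heval_var hrun_assign regs_set_neq // c0.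
apply: iteri_ind => [|i m' lt_i [cm' h]].
  by split; [apply: ctx_set|left; rewrite regs_set_eq].
set m2 := set_reg m' 15 i; have cm2 : ctx kap m2 by apply: ctx_set.
rewrite hrun_if heval_var; case: h => [[f h]|[f h]]; last first.
  by rewrite f; split; [apply: ctx_run cm2|right].
rewrite /m2 regs_set_neq // f eqxx -/m2.
have m2i : regs m2 15 = Ordinal lt_i by [].
have [cm3 e3 b3] := run_test cm2 m2i; split=> //.
case: (boolP (fails i)) => [fi|nf]; [right|left]; split.
- by rewrite e3.
- by exists (Ordinal lt_i).
- by apply/eqP; rewrite -[_ == _]negbK e3.
- move=> j; rewrite ltnS leq_eqVlt => /orP[/eqP -> //|]; exact: h.
Qed.

Lemma run_accept m : ctx kap m -> let m1 := hrun p_accept m in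
  [/\ ctx kap m1, regs m1 11 = 1 &
      forall v w : 'I_n, arrs m1 1 (v * n + w) = gue kap v w].
Proof.
move=> cm m1; split; first by apply: ctx_run cm.
  by rewrite /m1 /p_accept hrun_seq hrun_reg // hrun_assign regs_set_eq.
have c0 : regs m 0 = n by case: cm.
pose I i m' := ctx kap m' /\ forall v w : 'I_n, v < i ->
  arrs m' 1 (v * n + w) = gue kap v w.
suff [_ h] : I n m1 by move=> v w; apply: h.
rewrite /m1 /p_accept hrun_seq hrun_for heval_var hrun_assign regs_set_neq // c0.
apply: iteri_ind => [|i m' lt_i [cm' h]]; first by split; first exact: ctx_set.
set m2 := set_reg m' 13 i; have cm2 : ctx kap m2 by apply: ctx_set.
pose J j m' := [/\ ctx kap m', regs m' 13 = i & forall v w : 'I_n,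
  (v < i) || (val v == i) && (w < j) -> arrs m' 1 (v * n + w) = gue kap v w].
suff [cm3 _ h3] : J n (hrun (HFor 18 (HV 0)
    (HStore 1 (HAdd (e_mul (HV 0) (HV 13)) (HV 18)) (e_guess 13 18))) m2).
  split=> // v w; rewrite ltnS leq_eqVlt => vi; apply: h3.
  by rewrite ltn_ord andbT orbC.
have c20 : regs m2 0 = n by case: cm2.
rewrite hrun_for heval_var c20; apply: iteri_ind => [|j m3 lt_j [cm3 m3i h3]].
  by split=> // v w; rewrite andbF orbF => lt; apply: h.
have cm4 : ctx kap (set_reg m3 18 j) by apply: ctx_set.
split; [by apply: ctx_run cm4|by rewrite hrun_reg|].
move=> v w; rewrite arrs_store heval_add heval_mul // !heval_var regs_set_eq.
rewrite !regs_set_neq // m3i; have [-> _ _ _ _] := cm3.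
have [[ev ew]|ne] := (altP ((v, w) =P (Ordinal lt_i, Ordinal lt_j))).
  rewrite ev ew ifT ?[n * i]mulnC // => _; exact: heval_guess.
move=> lt; rewrite ifN.
  apply: h3; case/orP: lt => [->//|/andP[/eqP vi]].
  rewrite ltnS leq_eqVlt vi eqxx => /orP[/eqP wj|->]; last by rewrite orbT.
  case/eqP: ne; congr pair; exact: val_inj.
apply: contra ne => /eqP.
rewrite [n * i]mulnC => /(@index_inj _ v w (Ordinal lt_i) (Ordinal lt_j)) [-> ->].
exact: eqxx.
Qed.

End Fixed.

Lemma heval_quot m : regs m 2 = K -> regs m 12 <= regs m 3 ->
  heval m e_quot = regs m 12 %/ K.+1.
Proof.
move=> mK le; rewrite -(count_div (P := regs m 3)) //.
rewrite /e_quot heval_sum heval_var.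
apply: eq_bigr => i _; rewrite heval_le heval_mul // !heval_add !heval_var.
by rewrite regs_set_eq !regs_set_neq // mK !addn1.
Qed.

Lemma heval_digit m : regs m 2 = K -> regs m 12 <= regs m 3 ->
  heval m e_digit = regs m 12 %% K.+1.
Proof.
move=> mK le; rewrite /e_digit heval_sub heval_var heval_mul => [|i].
  rewrite heval_quot // heval_add !heval_var mK addn1 mulnC.
  by rewrite {1}(divn_eq (regs m 12) K.+1) addKn.
by rewrite !heval_quot.
Qed.

(* The number whose digits in base [K.+1] are the colours [col] of the vertices
   of [B], followed by the digits of [g]. *)
Definition tape (B : {set 'I_n}) (col : 'I_n -> nat) (g : nat) : seq 'I_n -> nat :=
  foldr (fun v t => if v \in B then col v + K.+1 * t else t) g.

Definition recolour (kap : 'I_n -> nat) (B : {set 'I_n}) (col : 'I_n -> nat) v :=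
  if v \in B then col v else kap v.

(** The vertices are visited in the order of [enum 'I_n], so the lowest digit left is always the
    colour of the next vertex of the batch. *)
Lemma run_colour kap m (B : {set 'I_n}) col g : ctx kap m ->
  (forall v : 'I_n, (arrs m 4 v != 0) = (v \in B)) -> (forall v, col v < K.+1) ->
  regs m 12 = tape B col g (enum 'I_n) -> regs m 12 <= regs m 3 ->
  let m1 := hrun p_colour m in
  regs m1 12 = g /\ ctx (recolour kap B col) m1.
Proof.
move=> cm mB colK m12 le m1; have [c0 c1 c2 a0 a2] := cm.
pose I i m' := [/\ regs m' 2 = K /\ regs m' 3 = regs m 3,
  regs m' 12 = tape B col g (drop i (enum 'I_n)) /\ regs m' 12 <= regs m' 3,
  forall v : 'I_n, (arrs m' 4 v != 0) = (v \in B) &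
  forall v : 'I_n, arrs m' 2 v = if (v < i) && (v \in B) then col v else kap v].
suff [_ [h12 _] _ h2] : I n m1.
  split; first by rewrite h12 drop_oversize // size_enum_ord.
  split; rewrite ?hrun_reg //; last by move=> v; rewrite h2 ltn_ord.
  by move=> k; rewrite hrun_arr.
rewrite /m1 /p_colour hrun_for heval_var c0.
apply: iteri_ind => [|i m' lt_i [[i2 i3] [i12 ile] i4 ia]].
  by split; rewrite ?drop0.
set v := Ordinal lt_i; set m2 := set_reg m' 13 v.
have e : drop i (enum 'I_n) = v :: drop i.+1 (enum 'I_n).
  rewrite (drop_nth v) ?size_enum_ord //; congr cons; apply: val_inj.
  by rewrite /= nth_enum_ord.
have m24 : heval m2 (HGet 4 (HV 13)) != 0 = (v \in B) by rewrite -i4.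
rewrite hrun_if m24; rewrite e /= in i12.
have ltS (u : 'I_n) : (u < i.+1) = (u == v) || (u < i).
  by rewrite ltnS leq_eqVlt.
case: ifP i12 => vB i12; last first.
  rewrite hrun_assign; split=> // u; rewrite [LHS]ia ltS.
  by case: eqP => // ->; rewrite vB andbF.
set m3 := hrun (HStore 2 (HV 13) e_digit) m2.
have q3 : heval m3 e_quot = tape B col g (drop i.+1 (enum 'I_n)).
  rewrite heval_quot // ?hrun_reg // ?regs_set_neq // i12 mulnC divnDMl //.
  by rewrite divn_small ?colK.
rewrite hrun_seq -/m3 hrun_assign q3; split.
- by split; rewrite regs_set_neq ?hrun_reg.
- rewrite regs_set_eq regs_set_neq // hrun_reg // regs_set_neq //; split=> //.
  apply: leq_trans ile; rewrite i12; apply: leq_trans (leq_addl _ _).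
  by rewrite leq_pmull.
- by move=> u; rewrite -i4.
- move=> u.
  have -> : arrs (set_reg m3 12 (tape B col g (drop i.+1 (enum 'I_n)))) 2 u =
    if val u == i then col v else arrs m' 2 u.
    rewrite [LHS]arrs_store heval_var regs_set_eq heval_digit ?regs_set_neq //.
    by rewrite i12 mulnC addnC modnMDl modn_small ?colK.
  rewrite ltS ia; case: (eqVneq u v) => [->|ne]; first by rewrite eqxx vB.
  by rewrite ifN //; apply: contra ne => /eqP e'; apply/eqP/val_inj.
Qed.

Notation batch kap := (batch K d G' kap).

Definition good_output (m : state) : Prop := exists2 kap, accepted K d G' kap &
  forall v w : 'I_n, arrs m 1 (v * n + w) = gue kap v w.

(** Holds during every guess, honest or not: a set flag certifies the output for some accepted
    colouring. *)
Definition run_inv (P : nat) (m : state) : Prop :=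
  [/\ exists kap, ctx kap m, regs m 3 = P & regs m 11 != 0 -> good_output m].

Lemma run_round kap P m : ctx kap m -> run_inv P m -> regs m 11 = 0 ->
  let m1 := hrun p_round m in run_inv P m1 /\
  (regs m1 11 != 0 \/ exists2 i, first_fail K d G' kap i &
     forall col g, (forall v, col v < K.+1) ->
       regs m 12 = tape (batch kap i) col g (enum 'I_n) -> regs m 12 <= P ->
       regs m1 12 = g /\ ctx (recolour kap (batch kap i) col) m1).
Proof.
move=> cm [_ mP _] done0 m1; rewrite /m1 /p_round hrun_seq hrun_if heval_var.
set m2 := hrun p_scan m; have [cm2 h] := run_scan cm.
case: h => [[f acc]|[f [i ff mk]]].
  rewrite ifF; last by rewrite f.
  have [cm3 d3 o3] := run_accept cm2; split; last by left; rewrite d3.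
  by split; [exists kap|rewrite !hrun_reg|exists kap].
rewrite ifT //; split.
  split; [|by rewrite !hrun_reg|by rewrite !hrun_reg // done0].
  exists (fun v => arrs (hrun p_colour m2) 2 v).
  have [c0 c1 c2 a0 a2] := cm2; split; rewrite 1?hrun_reg // => k.
  by rewrite hrun_arr.
right; exists i => // col g colK e le.
by apply: run_colour; rewrite // ?hrun_reg // mP.
Qed.

Section Colours.
Variable col : 'I_n -> nat.
Hypothesis col_le : forall v, col v < K.+1.

(* From colouring [kap] and remaining digits [g], the algorithm accepts after
   colouring at most [r] batches, all of them according to [col]. *)
Fixpoint win (r : nat) (kap : 'I_n -> nat) (g : nat) : Prop :=
  accepted K d G' kap \/
  if r is r'.+1 then exists i g', [/\ first_fail K d G' kap i,
    g = tape (batch kap i) col g' (enum 'I_n) &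
    win r' (recolour kap (batch kap i) col) g'] else False.

Lemma tape_ge B g s : g <= tape B col g s.
Proof.
elim: s => //= v s IH; case: ifP => // _; apply: leq_trans IH _.
by apply: leq_trans (leq_addl _ _); rewrite leq_pmull.
Qed.

Lemma tape_lt B g a s : g < K.+1 ^ a ->
  tape B col g s < K.+1 ^ (count (mem B) s + a).
Proof.
move=> lt; elim: s => //= v s IH; case: ifP => //= vB.
rewrite -addnA expnD expn1; have := col_le v; move: IH.
by move: (tape _ _ _ _) (_ ^ _) => t p; nia.
Qed.

Lemma run_rounds P m : run_inv P m -> run_inv P (hrun p_rounds m).
Proof.
move=> im; rewrite /p_rounds hrun_for.
apply: (@iteri_ind _ (fun=> run_inv P)) => // i m' _ [[kap cm'] mP gd].
have cm2 : ctx kap (set_reg m' 14 i) by apply: ctx_set.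
have im2 : run_inv P (set_reg m' 14 i) by split=> //; exists kap.
rewrite hrun_if heval_var.
case: (boolP (regs (set_reg m' 14 i) 11 != 0)) => [dn|/negPn/eqP d0].
  by split=> //; exists kap; apply: (ctx_set (x := 19)).
by have [] := run_round cm2 im2 d0.
Qed.

Lemma rounds_win P kap m : ctx kap m -> run_inv P m -> win K kap (regs m 12) ->
  regs m 12 <= P -> regs (hrun p_rounds m) 11 != 0.
Proof.
move=> cm im wm le.
(* [t] bounds the batches still to be coloured; after [K.+1] rounds [t + r = K] is impossible, so
   the flag is set. *)
pose I r m' := run_inv P m' /\ (regs m' 11 != 0 \/ exists t kap,
  [/\ t + r = K, ctx kap m', win t kap (regs m' 12) & regs m' 12 <= P]).
suff [_ [//|[t [kap' [e _ _ _]]]]] : I K.+1 (hrun p_rounds m) by lia.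
have c2 : regs m 2 = K by case: cm.
rewrite /p_rounds hrun_for heval_add heval_var c2 addn1.
apply: iteri_ind => [|r m' lt_r [im' h]].
  by split=> //; right; exists K, kap; rewrite addn0.
set m2 := set_reg m' 14 r; have im2 : run_inv P m2.
  have [[k ck] mP gd] := im'; split=> //; exists k; exact: ctx_set.
rewrite hrun_if heval_var; case: h => [dn|[t [kap' [e ck wk lek]]]].
  rewrite {1}/m2 regs_set_neq // dn; split; last by left.
  have [[k ck] mP gd] := im2; split=> //; exists k; exact: ctx_set.
case: (boolP (regs m2 11 != 0)) => [dn|/negPn/eqP d0].
  split; last by left.
  have [[k ck'] mP gd] := im2; split=> //; exists k; exact: ctx_set.
have ck2 : ctx kap' m2 by apply: ctx_set.
have := run_round ck2 im2 d0; move: (hrun p_round m2) => m3 [im3 h]; split=> //.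
case: h => [|[i ff h]]; [by left|right].
have nacc : ~ accepted K d G' kap' by move=> /(_ i); have [-> _] := ff.
case: t e wk => [|t] e /= wk; first by case: wk.
case: wk => // -[i' [g [ff' eg wg]]].
rewrite (first_fail_uniq ff' ff) in eg wg.
have [e12 cr] := h col g col_le eg lek.
exists t, (recolour kap' (batch kap' i) col); rewrite e12; split=> //; first by lia.
by apply: leq_trans lek; rewrite eg tape_ge.
Qed.
End Colours.

Lemma run_main P m g col : ctx (fun=> 0) m -> regs m 3 = P -> regs m 11 = 0 ->
  (forall v, col v < K.+1) -> g < P -> win col K (fun=> 0) g ->
  good_output (hrun p_main m).
Proof.
move=> cm mP d0 colK ltg wg.
(* An earlier guess may already have been accepted; then guess [g] is skipped and the flag stays
   set. *)
pose I i m' := run_inv P m' /\ (g < i -> regs m' 11 != 0).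
suff [[_ _ gd] h] : I P (hrun p_main m) by apply/gd/h.
rewrite /p_main hrun_for heval_var mP; apply: iteri_ind => [|i m' lt_i [im' h]].
  by split=> //; split; [exists (fun=> 0)|..|rewrite d0].
set m2 := set_reg m' 10 i; have im2 : run_inv P m2.
  have [[k ck] mP' gd] := im'; split=> //; exists k; exact: ctx_set.
rewrite hrun_if heval_var; case: (boolP (regs m2 11 != 0)) => [dn|/negPn/eqP d2].
  have [[k ck] mP' gd] := im2; split; last by move=> _; exact: dn.
  by split=> //; exists k; apply: (ctx_set (x := 19)).
rewrite /p_guess !hrun_seq; set m3 := hrun (HAssign 12 _) m2; set m4 := hrun _ m3.
have [[k ck] mP' _] := im2.
have c3 : ctx k m3 by apply: ctx_set.
have z4 : forall v : 'I_n, arrs m4 2 v = 0.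
  by apply: (hrun_fill (F := fun=> 0)) => //; case: c3.
have c4 : ctx (fun=> 0) m4.
  have [e0 e1 e2 b0 b2] := c3; split; rewrite 1?hrun_reg // => j.
  by rewrite hrun_arr.
have i4 : run_inv P m4.
  by split; [exists (fun=> 0)|rewrite !hrun_reg|rewrite !hrun_reg // d2].
split; first exact: run_rounds.
have e12 : regs m4 12 = i by rewrite hrun_reg.
rewrite ltnS leq_eqVlt => /orP[/eqP gi|lt].
  by apply: (rounds_win colK c4 i4); rewrite e12 -gi // ltnW.
by have := h lt; rewrite -[regs m' 11]/(regs m2 11) d2.
Qed.
End Execution.

(** * The guess that colours every batch by its true parts *)

Section Honest.
Variables (n d K : nat) (G : sgraph n) (R : pattern K) (part : 'I_n -> 'I_K).
Hypothesis sparseG : sparse d G setT.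

Notation G' := (complement_along G R part).
Notation rep kap := (represented (seed_size d) kap).

Definition part_colour (v : 'I_n) : nat := (part v).+1.

(** Each honestly coloured batch makes a new part represented, so [r] bounds the rounds left; each
    round uses at most [batch_size] digits. *)
Lemma win_exists r kap : (forall v, kap v != 0 -> kap v = part_colour v) ->
  K <= #|[set c : 'I_K | rep kap c]| + r ->
  exists2 g, g < K.+1 ^ (r * batch_size d K) & win d K G' part_colour r kap g.
Proof.
elim: r kap => [|r IH] kap hon le;
  (case: (accepted_or_fail K d G' kap) => [acc|[i ff]];
    first by exists 0; [rewrite expn_gt0|left]);
  have symG' : symmetric G' := adj_sym _;
  have [c [nc cB]] := batch_progress symG' (adj_sym G) (adj_irr G) (@padj_sym _ R)
    (fun _ _ => erefl) sparseG hon ff.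
  have : #|[set c : 'I_K | rep kap c]| < K.
    rewrite -[X in _ < X]card_ord -cardsT proper_card // properE subsetT /=.
    by apply/subsetPn; exists c; rewrite !inE.
  by rewrite addn0 in le; rewrite ltnNge le.
set B := batch K d G' kap i in cB *; set kap' := recolour kap B part_colour.
(* Recolouring a vertex that was already coloured gives it the same colour, so represented parts
   remain represented. *)
have cls_sub e : cls kap e \subset cls kap' e.
  apply/subsetP=> v; rewrite !inE /kap' /recolour => /eqP e'; case: ifP => _.
    by rewrite -hon e'.
  by rewrite e'.
have [||g ltg wg] := IH kap'.
- by move=> v; rewrite /kap' /recolour; case: ifP => // _; apply: hon.
- have : [set e : 'I_K | rep kap e] \proper [set e : 'I_K | rep kap' e].
    rewrite properE; apply/andP; split.
      apply/subsetP=> e; rewrite !inE => /leq_trans; apply.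
      exact/subset_leq_card.
    apply/subsetPn; exists c; rewrite inE // /represented.
    apply: leq_trans cB _; apply/subset_leq_card/subsetP => v; rewrite inE.
    by move=> /andP[vB /eqP pv]; rewrite inE /kap' /recolour vB /part_colour pv.
  move/proper_card => lt; apply: leq_trans le _.
  by rewrite addnS -addSn leq_add2r.
exists (tape K B part_colour g (enum 'I_n)); last by right; exists i, g.
apply: leq_trans (tape_lt _ _ _ ltg) _; first by move=> v; rewrite ltnS ltn_ord.
apply: leq_pexp2l => //; rewrite mulSn leq_add2r.
rewrite -sum1_count big_enum_cond sum1_card.
exact: (card_batch symG' ff).
Qed.
End Honest.

(** * Running time and conclusion *)

Definition guesses (d K : nat) : nat := K.+1 ^ (K * batch_size d K).

Lemma run_setup m : regs (hrun p_setup m) 3 = guesses (regs m 1) (regs m 2).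
Proof.
pose I i m' := [/\ regs m' 2 = regs m 2 & regs m' 3 = (regs m 2).+1 ^ i].
suff [] : I (regs m 2 * batch_size (regs m 1) (regs m 2)) (hrun p_setup m) by [].
rewrite /p_setup hrun_seq hrun_for heval_mul => [|i]; last by rewrite !heval_batch.
rewrite heval_var heval_batch hrun_assign.
apply: iteri_ind => [|i m' _ [i2 i3]]; first by split.
rewrite hrun_assign; split; first by rewrite !regs_set_neq.
rewrite regs_set_eq heval_mul // heval_add !heval_var !regs_set_neq //.
by rewrite i2 i3 addn1 expnS.
Qed.

(** All variables of the program are below 60, where the temporaries start. *)
Definition algorithm : cmd := ccode 60 (HSeq p_setup p_main).

Lemma algorithm_exec n d K (G' : sgraph n) : let s := graph_input d K G' in
  exists2 s', exec algorithm s s' (ccost s (HSeq p_setup p_main)) &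
    forall a i, arrs s' a i = arrs (hrun (HSeq p_setup p_main) s) a i.
Proof.
move=> s; have S : esim 60 id 60 s s by [].
by have [||s' E [[_ h] _]] := ccodeP (c := HSeq p_setup p_main) _ _ S; last exists s'.
Qed.

(** The two arguments are first moved to registers 1 and 2, where [p_setup] expects [d] and [K]. *)
Definition p_bound (C a : nat) : hcmd :=
  HSeq (HAssign 2 (HV 1)) (HSeq (HAssign 1 (HV 0)) (HSeq p_setup
    (HSeq (HAssign 4 (HAdd (HAdd (HV 1) (HV 2)) (HAdd (HV 3) (HC 1))))
      (HSeq (HAssign 5 (HC C))
        (HSeq (HFor 16 (HC a) (HAssign 5 (e_mul (HV 4) (HV 5))))
          (HAssign 0 (HV 5))))))).

Lemma run_bound C a m : regs (hrun (p_bound C a) m) 0 =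
  C * (regs m 0 + regs m 1 + (guesses (regs m 0) (regs m 1) + 1)) ^ a.
Proof.
rewrite /p_bound !hrun_seq !hrun_assign regs_set_eq heval_var.
set m1 := set_reg (set_reg m _ _) _ _; set m2 := hrun p_setup m1.
set m3 := set_reg m2 4 _; set m4 := set_reg m3 5 _.
pose Y := regs m 0 + regs m 1 + (guesses (regs m 0) (regs m 1) + 1).
have m3E : regs m3 4 = Y.
  by rewrite regs_set_eq !heval_add !heval_var run_setup !(hrun_reg (c := p_setup)).
pose I i m' := regs m' 4 = Y /\ regs m' 5 = C * Y ^ i.
suff [] : I a (hrun (HFor 16 (HC a) (HAssign 5 (e_mul (HV 4) (HV 5)))) m4) by [].
rewrite hrun_for; apply: (iteri_ind (P := I)) => [|i m' _ [i4 i5]].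
  by split; rewrite ?muln1 // regs_set_neq.
rewrite hrun_assign; split; first by rewrite !regs_set_neq.
rewrite regs_set_eq heval_mul // !heval_var !regs_set_neq // i4 i5.
by rewrite expnS mulnCA.
Qed.

Lemma bound_computable C a :
  computable2 (fun d K => C * (d + K + (guesses d K + 1)) ^ a).
Proof.
exists (ccode 60 (p_bound C a)) => d K.
set s := State _ _; have S : esim 60 id 60 s s by [].
have [||s' E [[h _] _]] := ccodeP (c := p_bound C a) _ _ S => //.
exists s', (ccost s (p_bound C a)); split=> //.
by have [_ ->] := h 0 isT; rewrite run_bound.
Qed.

(** The setup is polynomial in [d] and [K] alone. The main loop is polynomial in registers 0 to 3,
    all at most [Y * n.+1]; the exponent [a2] of [n.+1] is fixed by the program. *)
Lemma algorithm_fpt : fpt algorithm.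
Proof.
have [C1 [a1 b1]] : polybound (pred2 1 2) (fun m => ccost m p_setup).
  exact: cok_bound.
have [C2 [a2 b2]] : polybound (fun x => x < 4) (fun m => ccost m p_main).
  exact: cok_bound.
exists (fun d K => (C1 + C2) * (d + K + (guesses d K + 1)) ^ (a1 + a2)), a2.
split; first exact: bound_computable.
move=> n d K G'; have [s' E _] := algorithm_exec d K G'.
exists s', (ccost (graph_input d K G') (HSeq p_setup p_main)); split=> //.
set s := graph_input d K G'; set Y := d + K + (guesses d K + 1).
rewrite -[ccost _ _]/(ccost s p_setup + ccost (hrun p_setup s) p_main).
have Y0 : 0 < Y by rewrite /Y addnA addn1.
have h1 : ccost s p_setup <= C1 * Y ^ a1.
  by apply: b1 => // x /orP[]/eqP -> /=; rewrite /Y; lia.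
have h2 : ccost (hrun p_setup s) p_main <= C2 * (Y * n.+1) ^ a2.
  apply: b2; first by rewrite muln_gt0 Y0.
  have le x : x <= Y -> x <= Y * n.+1 by move/leq_trans; apply; rewrite leq_pmulr.
  case=> [_|[_|[_|[_|//]]]].
  - by rewrite hrun_reg //= (leq_trans (leqnSn n)) // leq_pmull.
  - by rewrite hrun_reg //=; apply: le; rewrite /Y; lia.
  - by rewrite hrun_reg //=; apply: le; rewrite /Y; lia.
  - by rewrite run_setup; apply: le; rewrite /Y /=; lia.
apply: leq_trans (leq_add h1 h2) _.
rewrite 2!mulnDl -2!mulnA leq_add // leq_mul2l; apply/orP; right.
  apply: leq_trans (leq_pmulr _ _); last by rewrite expn_gt0.
  by rewrite leq_pexp2l // leq_addr.
by rewrite expnMn leq_mul2r leq_pexp2l ?leq_addl ?orbT.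
Qed.

Theorem theorem5 :
  exists A : cmd, fpt A /\
    forall d K : nat, 0 < d -> 0 < K ->
      exists m : nat,
        forall (n : nat) (G : sgraph n) (R : pattern K) (part : 'I_n -> 'I_K),
          degenerate d G ->
          exists H : sgraph n,
            [/\ outputs A d K (complement_along G R part) H,
                agree_upto m G H
              & degenerate (d + m) H].
Proof.
exists algorithm; split; first exact: algorithm_fpt.
move=> d K _ _; exists (agree_bound d K + junk_bound d K) => n G R part degG.
have sparseG := degenerate_sparse degG; set G' := complement_along G R part.
have symG' : symmetric G' := adj_sym _.
set s := graph_input d K G'; have [s' E arrE] := algorithm_exec d K G'.
(* Initially no vertex is coloured, which is trivially honest, and [K] rounds are available. *)
have [//|g ltg wg] := win_exists R (part := part) sparseG (r := K)
  (kap := fun=> 0) _ (leq_addl _ _).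
have [kap acc out] : good_output d K G' (hrun p_main (hrun p_setup s)).
  apply: (run_main (P := guesses d K) _ _ _ _ ltg wg).
  - by split; rewrite ?hrun_reg // => k; rewrite hrun_arr.
  - exact: run_setup.
  - by rewrite hrun_reg.
  - by move=> v; rewrite ltnS ltn_ord.
pose H := SGraph (guess_sym K (seed_size d) kap symG')
  (@guess_irr n K (seed_size d) G' kap).
have agr : agree_upto (agree_bound d K + junk_bound d K) G H.
  exact: (accepted_agree symG' (adj_irr G) (fun _ _ => erefl) sparseG acc).
exists H; split=> //; last exact: agree_degenerate degG agr.
by exists s', (ccost s (HSeq p_setup p_main)); split=> // i j; rewrite arrE out.
Qed.
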